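(* Under the unequal-cluster-size setting in the context (null log-linear model true), for any admissible $\phi$, \[ \sqrt{N}\big(\widehat{\boldsymbol{p}}-\boldsymbol{p}(\widehat{\boldsymbol{\theta}}_{\phi})\big)\xrightarrow[N\to\infty]{\mathcal{L}}\mathcal{N}\Big(\boldsymbol{0}_M,\ \tfrac{\vartheta_{n^*}}{\bar n}\big(\boldsymbol{\Sigma}_{\boldsymbol{p}(\boldsymbol{\theta}_0)}-\boldsymbol{\Sigma}_{\boldsymbol{p}(\boldsymbol{\theta}_0)}\boldsymbol{W}(\boldsymbol{W}^T\boldsymbol{\Sigma}_{\boldsymbol{p}(\boldsymbol{\theta}_0)}\boldsymbol{W})^{-1}\boldsymbol{W}^T\boldsymbol{\Sigma}_{\boldsymbol{p}(\boldsymbol{\theta}_0)}\big)\Big), \] where $\bar n=\sum_{g=1}^G N_g^*n_g$ and $\vartheta_{n^*}=1+\rho^2(n^*-1)$.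
   Context: Let $M\ge 3$ and $1\le M_0<M-1$. Let $\boldsymbol{W}$ be a real $M\times M_0$ matrix of full column rank whose columns, together with $\boldsymbol{1}_M$, are linearly independent; $\boldsymbol{p}(\boldsymbol{\theta})=\exp\{\boldsymbol{W}\boldsymbol{\theta}\}/(\boldsymbol{1}_M^T\exp\{\boldsymbol{W}\boldsymbol{\theta}\})$ for $\boldsymbol{\theta}\in\mathbb{R}^{M_0}$; $\boldsymbol{D}_{\boldsymbol{p}}=\mathrm{diag}(\boldsymbol{p})$, $\boldsymbol{\Sigma}_{\boldsymbol{p}}=\boldsymbol{D}_{\boldsymbol{p}}-\boldsymbol{p}\boldsymbol{p}^T$. Unequal cluster sizes: there are $G$ groups of clusters; group $g$ contains $N_g$ clusters, each of size $n_g\ge2$ (distinct $n_g$); $N=\sum_{g=1}^G N_g$, and $N_g/N\to N_g^*\in(0,1]$ as $N\to\infty$. The cluster frequency vectors $\boldsymbol{Y}^{(g,\ell)}$, $\ell=1,\dots,N_g$, $g=1,\dots,G$, are independent, with nonnegative integer entries summing to $n_g$, identically distributed within each group, $\mathrm{E}[\boldsymbol{Y}^{(g,\ell)}]=n_g\boldsymbol{p}(\boldsymbol{\theta}_0)$, $\mathrm{Var}[\boldsymbol{Y}^{(g,\ell)}]=\vartheta_{n_g}n_g\boldsymbol{\Sigma}_{\boldsymbol{p}(\boldsymbol{\theta}_0)}$, $\vartheta_{n_g}=1+(n_g-1)\rho^2$, $\rho^2\ge0$, $\boldsymbol{\theta}_0$ the unknown true parameter. Let $\boldsymbol{Y}=\sum_g\sum_\ell\boldsymbol{Y}^{(g,\ell)}$,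 $\widehat{\boldsymbol{p}}=\boldsymbol{Y}/\sum_{h}n_hN_h$. Let $w_g^*=N_g^*n_g/\sum_h N_h^*n_h$ and $n^*=\sum_g w_g^*n_g$. Admissible $\phi:(0,\infty)\to\mathbb{R}$: convex, twice continuously differentiable, $\phi(1)=\phi'(1)=0$, $\phi''(1)>0$, conventions $0\phi(0/0)=0$, $0\phi(p/0)=p\lim_{u\to\infty}\phi(u)/u$; $d_\phi(\boldsymbol{p},\boldsymbol{q})=\sum_r q_r\phi(p_r/q_r)$; QM$\phi$E $\widehat{\boldsymbol{\theta}}_\phi=\arg\min_{\boldsymbol{\theta}}d_\phi(\widehat{\boldsymbol{p}},\boldsymbol{p}(\boldsymbol{\theta}))$ (assumed well defined). *)

(* Defs.v *)
From HB Require Import structures.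
From mathcomp Require Import all_boot all_order all_algebra.
From mathcomp Require Import all_classical all_reals all_analysis.
Set Implicit Arguments. Unset Strict Implicit. Unset Printing Implicit Defensive.
Import Order.TTheory GRing.Theory Num.Theory.
Import numFieldNormedType.Exports.
Local Open Scope classical_set_scope.
Local Open Scope ring_scope.

Section Defs.
Variable R : realType.

Definition ploglin (M M0 : nat) (W : 'M[R]_(M, M0)) (theta : 'cV[R]_M0)
  : 'cV[R]_M :=
  let e := map_mx expR (W *m theta) in
  (\sum_(r < M) e r ord0)^-1 *: e.

Definition Dp (M : nat) (p : 'cV[R]_M) : 'M[R]_M := diag_mx p^T.
Definition Sigmap (M : nat) (p : 'cV[R]_M) : 'M[R]_M := Dp p - p *m p^T.

Definition convex_on_pos (phi : R -> R) : Prop :=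
  forall x y t : R, 0 < x -> 0 < y -> 0 <= t <= 1 ->
    phi (t * x + (1 - t) * y) <= t * phi x + (1 - t) * phi y.

Definition admissible (phi : R -> R) : Prop :=
  [/\ convex_on_pos phi,
      (forall x : R, 0 < x ->
         [/\ derivable phi x 1, derivable (derive1 phi) x 1
           & {for x, continuous (derive1 (derive1 phi))}]),
      phi 1 = 0, derive1 phi 1 = 0 & 0 < derive1 (derive1 phi) 1].

Definition phi_at0 (phi : R -> R) : \bar R :=
  lim ((phi u)%:E @[u --> 0^'+]).
Definition phi_slope_oo (phi : R -> R) : \bar R :=
  lim ((phi u / u)%:E @[u --> +oo]).

(* q * phi(p/q) with the conventions 0 phi(0/0) = 0,
   0 phi(p/0) = p lim_{u->oo} phi(u)/u, and phi(0) = phi(0+) *)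
Definition phi_term (phi : R -> R) (p q : R) : \bar R :=
  if 0 < q then
    (if 0 < p then ((q * phi (p / q))%:E) else (q%:E * phi_at0 phi)%E)
  else if p == 0 then 0%E else (p%:E * phi_slope_oo phi)%E.

Definition dphi (phi : R -> R) (M : nat) (p q : 'cV[R]_M) : \bar R :=
  (\sum_(r < M) phi_term phi (p r ord0) (q r ord0))%E.

Definition rvec {d} {T : measurableType d} (M : nat) (X : T -> 'cV[R]_M)
  : Prop := forall i : 'I_M, measurable_fun setT (fun w => X w i ord0).

Definition rect_event {T : Type} (M : nat) (X : T -> 'cV[R]_M)
  (B : 'I_M -> set R) : set T := [set w | forall i, B i (X w i ord0)].

Definition mrect (M : nat) (B : 'I_M -> set R) : Prop :=
  forall i, measurable (B i).

Definition mutually_independent {d} {T : measurableType d}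
  (P : probability T R) (K : finType) (M : nat) (X : K -> T -> 'cV[R]_M)
  : Prop :=
  forall B : K -> 'I_M -> set R, (forall k, mrect (B k)) ->
    P (\bigcap_(k in [set: K]) rect_event (X k) (B k))
    = (\prod_(k : K) P (rect_event (X k) (B k)))%E.

Definition same_law {d} {T : measurableType d} (P : probability T R)
  (M : nat) (X Y : T -> 'cV[R]_M) : Prop :=
  forall B : 'I_M -> set R, mrect B ->
    P (rect_event X B) = P (rect_event Y B).

(* Z ~ N(0_M, S) : characteristic function E[exp(i t^T Z)] = exp(-t^T S t/2),
   written through its real and imaginary parts *)
Definition gaussian0 {d} {T : measurableType d} (Q : probability T R)
  (M : nat) (Z : T -> 'cV[R]_M) (S : 'M[R]_M) : Prop :=
  rvec Z /\
  forall t : 'cV[R]_M,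
    (\int[Q]_w (cos ((t^T *m Z w) ord0 ord0))%:E
       = (expR (- ((t^T *m S *m t) ord0 ord0) / 2))%:E)%E /\
    (\int[Q]_w (sin ((t^T *m Z w) ord0 ord0))%:E = 0)%E.

Definition conv_in_law {d} {T : measurableType d} (P : probability T R)
  {d'} {T' : measurableType d'} (Q : probability T' R)
  (M : nat) (X : nat -> T -> 'cV[R]_M) (Z : T' -> 'cV[R]_M) : Prop :=
  forall f : 'cV[R]_M -> R, continuous f ->
    (exists C : R, forall x, `|f x| <= C) ->
    ((\int[P]_w (f (X N w))%:E) @[N --> \oo] --> (\int[Q]_w (f (Z w))%:E))%E.

End Defs.

(* Main.v *)
Require Import Defs.
From HB Require Import structures.
From mathcomp Require Import all_boot all_order all_algebra.
From mathcomp Require Import all_classical all_reals all_analysis.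
From mathcomp Require Import measurable_realfun.
From mathcomp Require Import ring lra.
From mathcomp Require Import complex.
Set Implicit Arguments. Unset Strict Implicit. Unset Printing Implicit Defensive.
Import Order.TTheory GRing.Theory Num.Theory.
Import numFieldNormedType.Exports.
Local Open Scope classical_set_scope.
Local Open Scope ring_scope.

(** Write x for phat - p(theta0) and h for theta - theta0.  Admissibility makes
the divergence coercive: phi(u) >= k (|u - 1| - e), so once x is small a
minimizer exists and lies close to theta0.  There stationarity and
phi(u) - u phi'(u) = - phi''(1) (u - 1) + o(u - 1) give
W^T (phat - p(thetahat)) = o(|phat - p(thetahat)|); together with
p(theta0 + h) = p(theta0) + Sigma W h + o(h) this yields
phat - p(thetahat) = (1 - Sigma W (W^T Sigma W)^-1 W^T) x + o(|x|), uniformly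
in the sample.  It remains to treat sqrt(N) x, a sum of independent bounded
vectors: its characteristic function is a product whose factors are
1 - sigma_k^2 / 2 + O(N^(-3/2)), Chebyshev gives tightness, and a continuous
function is approximated on a large ball by polynomials in sin(x_i / 2K)
(Bernstein polynomials), i.e. by trigonometric polynomials, so that convergence
of characteristic functions on a tight sequence implies convergence in law. *)

(** * Expansions at a point *)

(** Nothing is known about uniqueness or smoothness of the estimator: [thetahat] only minimizes at
    samples where a minimizer exists. The expansion is therefore proved for every minimizer, at
    every deterministic [p] close to [p(theta0)], and probability enters afterwards only through
    events [|sqrt(N) x| <= K]. Closeness to [p(theta0)] also forces positive entries, so the
    extended-real divergence is a finite real sum there.

    The clusters form a triangular array ([Y] depends on [N]), so the limit rests on a bound for
    each [N]. Counts are at most the sum of the group sizes: all clusters take values in one finite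
    set, expectations become finite sums, and each summand of [t^T sqrt(N) x] is at most a constant
    over [sqrt(N)].

    The sine substitution has two merits. Products of sines are again linear combinations of sines
    and cosines. And the Bernstein weights stay a probability for every [x], so the approximant
    keeps the bound of [f] outside the ball, where only tightness helps. The same approximation
    yields measurability of [f \o X] from that of the coordinates. *)

Section analysis.
Variable R : realType.

Lemma continuous_mx (T : topologicalType) m n (f : T -> 'M[R]_(m, n)) x :
  (forall i j, {for x, continuous (fun y => f y i j)}) -> {for x, continuous f}.
Proof.
move=> fc U [P fxP PU].
have : \forall y \near x, forall i j, P i j (f y i j).
  apply: filter_forall => i; apply: filter_forall => j.
  exact: fc.
by apply: filterS => y Py; exact: PU.
Qed.

Lemma derive1_expansion (f : R -> R) (x e : R) : derivable f x 1 -> 0 < e ->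
  exists2 d, 0 < d & forall u, `|u - x| < d ->
    `|f u - f x - derive1 f x * (u - x)| <= e * `|u - x|.
Proof.
move=> df e0.
have /cvgrPdist_le/(_ e e0) : h^-1 *: (f (h%:A + x) - f x) @[h --> 0^'] --> derive1 f x.
  by rewrite derive1E; exact: df.
rewrite near_withinE => /nbhs_ballP[d /= d0 H]; exists d => // u ud.
have [->|ux] := eqVneq u x; first by rewrite !subrr mulr0 subrr normr0 mulr0.
have ux0 : u - x != 0 by rewrite subr_eq0.
have := H (u - x).
rewrite /ball /= sub0r normrN => /(_ ud ux0).
rewrite [(u - x) *: 1]mulr1 subrK => {}H.
rewrite -(@ler_pM2r _ (`|u - x|)) ?normr_gt0// in H.
apply: le_trans H; rewrite -normrM distrC mulrBl /GRing.scale/= mulrAC mulVf// mul1r.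
by rewrite le_eqVlt; apply/orP; left; apply/eqP; congr (`|_|); ring.
Qed.

End analysis.

(** * Local expansion and linear growth of an admissible [phi] *)

Section phi.
Variables (R : realType) (phi : R -> R).
Hypothesis phia : admissible phi.
Let c := derive1 (derive1 phi) 1.

Lemma phi_continuous x : 0 < x -> {for x, continuous phi}.
Proof.
move=> x0; have [_ /(_ x x0)[d1 _ _] _ _ _] := phia.
by apply/differentiable_continuous/derivable1_diffP.
Qed.

Lemma phi_deriv_expansion e : 0 < e -> exists2 d, 0 < d &
  forall u, `|u - 1| < d -> `|derive1 phi u - c * (u - 1)| <= e * `|u - 1|.
Proof.
move=> e0; have [_ /(_ 1 ltr01)[d1 d2 _] _ p1 _] := phia.
have [d d0 H] := derive1_expansion d2 e0; exists d => // u /H.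
by rewrite p1 subr0.
Qed.

(** The expression [phi u - u * phi' u] is the derivative of [q * phi (p / q)] in [q] at
    [u = p / q], so this is the expansion of the score. Splitting [u * phi' u] as
    [phi' u + (u - 1) * phi' u] leaves [phi u = o(u - 1)], the error in [phi' u], and a second-order
    term. *)
Lemma phi_score_expansion e : 0 < e -> exists2 d, 0 < d &
  forall u, `|u - 1| < d ->
    `|phi u - u * derive1 phi u + c * (u - 1)| <= e * `|u - 1|.
Proof.
move=> e0; have [_ /(_ 1 ltr01)[d1 _ _] p0 p1 c0] := phia.
have e4 : 0 < e / 4 by rewrite divr_gt0.
have [a a0 Ha] := phi_deriv_expansion e4.
have [b b0 Hb] := derive1_expansion d1 e4.
(* Chosen so that [|phi' u| <= (c + e/4) |u - 1|] is at most [e/4] when [|u - 1| < s]. *)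
pose s := e / 4 / (c + e / 4).
have ce0 : 0 < c + e / 4 by rewrite addr_gt0.
have s0 : 0 < s by rewrite divr_gt0.
exists (Num.min (Num.min a b) (Num.min s 1)); first by rewrite !lt_min a0 b0 s0/=.
move=> u; rewrite !lt_min => /andP[/andP[ua ub] /andP[us u1]].
move: (Ha u ua) (Hb u ub); rewrite p0 p1 !subr0 mul0r subr0 => h1 h2.
have h3 : `|(u - 1) * derive1 phi u| <= e / 4 * `|u - 1|.
  rewrite normrM mulrC ler_wpM2r//.
  have : `|derive1 phi u| <= (c + e / 4) * `|u - 1|.
    rewrite -[derive1 phi u](subrK (c * (u - 1))) (le_trans (ler_normD _ _))//.
    by rewrite mulrDl addrC lerD// normrM (ger0_norm (ltW c0)).
  move=> /le_trans; apply.
  by rewrite -ler_pdivlMl// mulrC ltW.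
have -> : phi u - u * derive1 phi u + c * (u - 1) =
  phi u - (derive1 phi u - c * (u - 1)) - (u - 1) * derive1 phi u by ring.
rewrite (le_trans (ler_normB _ _))// (le_trans (lerD (ler_normB _ _) (lexx _)))//.
apply: le_trans (lerD (lerD h2 h1) h3) _.
by have := mulr_ge0 (ltW e0) (normr_ge0 (u - 1)); lra.
Qed.

(** Since [phi''(1) > 0], [phi'] has the sign of [v - 1] near 1; the mean value theorem between 1
    and [u] then gives [phi u > 0] on both sides. *)
Lemma phi_near1_pos : exists2 d, 0 < d < 1 &
  forall u, `|u - 1| < d -> u != 1 -> 0 < phi u.
Proof.
have [_ phid p0 p1 c0] := phia.
have {}c0 : 0 < c by [].
have c2 : 0 < c / 2 by rewrite divr_gt0.
have [d d0 H] := phi_deriv_expansion c2.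
have d10 : 0 < Num.min d (2^-1) by rewrite lt_min d0/= invr_gt0.
exists (Num.min d (2^-1)).
  by rewrite d10/= gt_min invf_lt1// ltr1n orbT.
move=> u; rewrite lt_min => /andP[ud u2] u1.
have u0 : 0 < u.
  by move: u2; rewrite ltr_norml => /andP[]; lra.
have [uge|ult] := ltP 1 u.
  have [v] : exists2 v, v \in `]1, u[%R & phi u - phi 1 = derive1 phi v * (u - 1).
    apply: MVT => //.
      move=> x; rewrite in_itv/= => /andP[x1 _].
      rewrite derive1E; apply: derivableP.
      by case: (phid x (lt_trans ltr01 x1)) => ? _ _; assumption.
    apply: continuous_in_subspaceT => x; rewrite inE/= in_itv/= => /andP[x1 _].
    by apply: phi_continuous; exact: lt_le_trans x1.
  rewrite p0 subr0 => vu ->.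
  move: vu; rewrite in_itv/= => /andP[v1 vu].
  rewrite mulr_gt0 ?subr_gt0//.
  have := H v; rewrite (gtr0_norm (_ : 0 < v - 1)) ?subr_gt0//.
  have -> : v - 1 < d by rewrite gtr0_norm ?subr_gt0// in ud; lra.
  have : 0 < c * (v - 1) by rewrite mulr_gt0 ?subr_gt0.
  by move=> h /(_ isT); rewrite ler_norml => /andP[h1 _]; lra.
have {}ult : u < 1 by rewrite lt_neqAle u1.
have [v] : exists2 v, v \in `]u, 1[%R & phi 1 - phi u = derive1 phi v * (1 - u).
  apply: MVT => //.
    move=> x; rewrite in_itv/= => /andP[x1 _].
    rewrite derive1E; apply: derivableP.
    by case: (phid x (lt_trans u0 x1)) => ? _ _; assumption.
  apply: continuous_in_subspaceT => x; rewrite inE/= in_itv/= => /andP[x1 _].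
  exact/phi_continuous/(lt_le_trans u0).
rewrite p0 sub0r => vu /eqP; rewrite eqr_oppLR => /eqP ->.
move: vu; rewrite in_itv/= => /andP[v1 vu].
rewrite -mulNr mulr_gt0 ?subr_gt0//.
have := H v; rewrite distrC (gtr0_norm (_ : 0 < 1 - v)) ?subr_gt0//.
have -> : 1 - v < d by rewrite distrC gtr0_norm ?subr_gt0// in ud; lra.
have : 0 < c * (1 - v) by rewrite mulr_gt0 ?subr_gt0.
by move=> h /(_ isT); rewrite ler_norml => /andP[_ h1]; lra.
Qed.

(** By convexity and [phi 1 = 0], the slope of [phi] seen from 1 does not decrease along a ray, so
    positivity at [1 + s] and [1 - s] propagates to linear growth beyond distance [s]. The slack
    [e >= s] makes the bound nonpositive inside. *)
Lemma phi_ge_linear e : 0 < e -> exists2 k, 0 < k &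
  forall u, 0 < u -> k * (`|u - 1| - e) <= phi u.
Proof.
move=> e0; have [d /andP[d0 d1] H] := phi_near1_pos.
have [cv _ p0 _ _] := phia.
pose s := Num.min (d / 2) e.
have s0 : 0 < s by rewrite lt_min e0 divr_gt0.
have sd : s < d by rewrite gt_min ltr_pdivrMr// ltr_pMr// ltr1n.
have se : s <= e by rewrite ge_min lexx orbT.
have pp : 0 < phi (1 + s).
  have e1 : 1 + s - 1 = s by ring.
  by apply: H; [rewrite e1 gtr0_norm | rewrite gt_eqF// ltrDl].
have pm : 0 < phi (1 - s).
  have e1 : 1 - s - 1 = - s by ring.
  by apply: H; [rewrite e1 normrN gtr0_norm | rewrite lt_eqF// gtrBl].
pose k := Num.min (phi (1 + s)) (phi (1 - s)) / s.
have k0 : 0 < k by rewrite divr_gt0// lt_min pp.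
exists k => // u u0.
have [us|us] := leP (`|u - 1|) s.
  have : 0 <= phi u.
    have [->|u1] := eqVneq u 1; first by rewrite p0.
    by apply/ltW/H => //; exact: le_lt_trans sd.
  apply: le_trans; apply: mulr_ge0_le0; [exact: ltW|lra].
apply: (@le_trans _ _ (k * `|u - 1|)); first by rewrite ler_pM2l//; lra.
have n0 : 0 < `|u - 1| by lra.
(* The convex combination of [u] and 1 with this weight on [u] is [1 + s] or [1 - s]. *)
have t01 : 0 <= s / `|u - 1| <= 1.
  by rewrite ler_pdivrMr// mul1r (ltW us) divr_ge0// ltW.
have := cv u 1 (s / `|u - 1|) u0 ltr01 t01.
rewrite p0 mulr0 addr0 mulr1 => h.
have kE : k * s = Num.min (phi (1 + s)) (phi (1 - s)) by rewrite /k divfK// gt_eqF.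
suff : k * s <= s / `|u - 1| * phi u.
  have -> : s / `|u - 1| * phi u = phi u / `|u - 1| * s by ring.
  by rewrite ler_pM2r// ler_pdivlMr.
rewrite kE; apply: le_trans h; rewrite ge_min.
have [u1|u1] := leP 1 u.
  apply/orP; left.
  rewrite ger0_norm in n0 *; last by lra.
  by rewrite le_eqVlt; apply/orP; left; apply/eqP; congr phi; field; lra.
apply/orP; right.
rewrite ltr0_norm in n0 *; last by lra.
by rewrite le_eqVlt; apply/orP; left; apply/eqP; congr phi; field; lra.
Qed.

End phi.

(** * Log-linear models *)

Section bigcvg.
Variable R : realType.

Lemma cvg_bigsum (T : Type) (F : set_system T) {FF : Filter F} (I : Type) (r : seq I)
    (f : I -> T -> R) (l : I -> R) : (forall i, f i x @[x --> F] --> l i) ->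
  (\sum_(i <- r) f i x) @[x --> F] --> \sum_(i <- r) l i.
Proof.
move=> fl; elim: r => [|i r ih].
  by rewrite big_nil; under eq_fun do rewrite big_nil; exact: cvg_cst.
rewrite big_cons; under eq_fun do rewrite big_cons.
by apply: cvgD => //; exact: fl.
Qed.

Lemma mxnorm_le (m n : nat) (A : 'M[R]_(m, n)) (e : R) : 0 <= e ->
  (`|A| <= e) = [forall i, forall j, `|A i j| <= e].
Proof.
move=> e0; rewrite [`|A|]mx_normrE; apply/idP/idP.
  move=> /bigmax_leP[_ H]; apply/forallP => i; apply/forallP => j.
  exact: (H (i, j)).
move=> /forallP H; apply/bigmax_leP; split => // -[i j] _ /=.
by have /forallP := H i; exact.
Qed.

Lemma mxentry_le_norm (m n : nat) (A : 'M[R]_(m, n)) i j : `|A i j| <= `|A|.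
Proof.
have := lexx `|A|; rewrite {1}mxnorm_le// => /forallP/(_ i)/forallP; exact.
Qed.

Lemma mxnorm_leP (m n : nat) (A : 'M[R]_(m, n)) (e : R) : 0 <= e ->
  (forall i j, `|A i j| <= e) -> `|A| <= e.
Proof.
by move=> e0 H; rewrite mxnorm_le//; apply/forallP => i; apply/forallP => j.
Qed.

(** The norm is the largest absolute entry, hence the factor given by the inner dimension; it
    reappears in the constants below. *)
Lemma norm_mulmx (m n p : nat) (A : 'M[R]_(m, n)) (B : 'M[R]_(n, p)) :
  `|A *m B| <= n%:R * `|A| * `|B|.
Proof.
apply: mxnorm_leP; first by rewrite !mulr_ge0.
move=> i j; rewrite mxE (le_trans (ler_norm_sum _ _ _))//.
rewrite (@le_trans _ _ (\sum_(k < n) `|A| * `|B|))//.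
  by apply: ler_sum => k _; rewrite normrM ler_pM// mxentry_le_norm.
by rewrite sumr_const card_ord -(mulr_natl (`|A| * `|B|)) mulrA.
Qed.

Lemma entryB (m n : nat) (A B : 'M[R]_(m, n)) i j : (A - B) i j = A i j - B i j.
Proof. by rewrite !mxE. Qed.

End bigcvg.

Section continuous_for.
Variables (R : realType) (T : topologicalType).
Implicit Types (f g : T -> R) (x : T).

Lemma continuous_forM f g x : {for x, continuous f} -> {for x, continuous g} ->
  {for x, continuous (fun y => f y * g y)}.
Proof. exact: cvgM. Qed.

Lemma continuous_forB f g x : {for x, continuous f} -> {for x, continuous g} ->
  {for x, continuous (fun y => f y - g y)}.
Proof. exact: cvgB. Qed.

Lemma continuous_forV f x : f x != 0 -> {for x, continuous f} ->
  {for x, continuous (fun y => (f y)^-1)}.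
Proof. by move=> fx0; exact: cvgV. Qed.

Lemma continuous_for_sum (I : Type) (r : seq I) (f : I -> T -> R) x :
  (forall i, {for x, continuous (f i)}) ->
  {for x, continuous (fun y => \sum_(i <- r) f i y)}.
Proof. exact: cvg_bigsum. Qed.

Lemma continuous_for_cst (c : R) x : {for x, continuous (fun _ : T => c)}.
Proof. exact: cvg_cst. Qed.

End continuous_for.

Lemma is_derive_expR_affine (R : realType) (a b t : R) :
  is_derive t 1 (fun u : R => expR (a + b * u)) (b * expR (a + b * t)).
Proof.
have dA : is_derive t 1 (fun u : R => a + b * u) b.
  have := is_deriveD (is_derive_cst a t 1) (is_deriveZ b (is_derive_id t 1)).
  by rewrite add0r [b *: 1]mulr1.
by rewrite mulrC; exact: is_derive1_comp (is_derive_expR _) dA.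
Qed.

(** * First-order calculus of [p(theta)] *)

Section loglinear.
Variables (R : realType) (M M0 : nat) (W : 'M[R]_(M, M0)).
Hypothesis M_gt0 : (0 < M)%N.
Implicit Types (theta v : 'cV[R]_M0) (p s : 'cV[R]_M).

Lemma ploglinE theta r : ploglin W theta r 0 =
  (\sum_k expR ((W *m theta) k 0))^-1 * expR ((W *m theta) r 0).
Proof.
rewrite /ploglin !mxE; congr (_^-1 * _).
by apply: eq_bigr => k _; rewrite mxE.
Qed.

Lemma sum_expR_gt0 (a : 'I_M -> R) : 0 < \sum_k expR (a k).
Proof.
case: M M_gt0 a => // m _ a; rewrite big_ord_recl ltr_pwDl ?expR_gt0//.
by apply: sumr_ge0 => i _; exact: expR_ge0.
Qed.

Lemma ploglin_gt0 theta r : 0 < ploglin W theta r 0.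
Proof. by rewrite ploglinE mulr_gt0 ?expR_gt0// invr_gt0 sum_expR_gt0. Qed.

Lemma sum_ploglin theta : \sum_r ploglin W theta r 0 = 1.
Proof.
under eq_bigr do rewrite ploglinE.
by rewrite -mulr_sumr mulVf// gt_eqF// sum_expR_gt0.
Qed.

(** Multiplication by [Sigmap p] centres [s] at its [p]-mean and reweights by [p]. This is the shape
    in which the softmax derivative and the information form both appear. *)
Lemma SigmapE p s r :
  (Sigmap p *m s) r 0 = p r 0 * (s r 0 - \sum_k p k 0 * s k 0).
Proof.
rewrite /Sigmap mulmxBl /Dp mul_diag_mx -mulmxA !mxE mulrBr; congr (_ - _).
rewrite big_ord1 !mxE; congr (_ * _).
by apply: eq_bigr => k _; rewrite !mxE.
Qed.

Lemma Sigmap_entry p i j :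
  Sigmap p i j = (i == j)%:R * p i 0 - p i 0 * p j 0.
Proof. by rewrite /Sigmap /Dp entryB !mxE big_ord1 !mxE mulr_natl. Qed.

(** Derivatives are taken along lines only: a one-variable derivative suffices for the mean value
    theorem in [ploglin_expansion] and for Fermat's rule in [stationary]. *)
Lemma ploglin_line_derive theta v (r : 'I_M) (t : R) :
  is_derive t 1 (fun t : R => ploglin W (theta + t *: v) r 0)
    ((Sigmap (ploglin W (theta + t *: v)) *m (W *m v)) r 0).
Proof.
pose N k t := expR ((W *m theta) k 0 + (W *m v) k 0 * t).
have NE k u : expR ((W *m (theta + u *: v)) k 0) = N k u.
  by rewrite mulmxDr -scalemxAr mxE [X in _ + X]mxE /N [u * _]mulrC.
have dN k : is_derive t 1 (N k) ((W *m v) k 0 * N k t) by exact: is_derive_expR_affine.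
pose D := \sum_k N k.
have DE u : D u = \sum_k N k u by rewrite /D fct_sumE.
have D0 u : D u != 0 by rewrite DE gt_eqF// sum_expR_gt0.
have dD : is_derive t 1 D (\sum_k (W *m v) k 0 * N k t) by exact: is_derive_sum.
have fE : (fun t => ploglin W (theta + t *: v) r 0) = (fun u => (D u)^-1) * N r.
  apply/funext => u; rewrite ploglinE NE.
  by under eq_bigr do rewrite NE; rewrite -DE.
rewrite fE; have dV := is_deriveV (D0 t) dD.
have pE k : ploglin W (theta + t *: v) k 0 = (D t)^-1 * N k t.
  by rewrite ploglinE NE; under eq_bigr do rewrite NE; rewrite -DE.
apply: is_derive_eq; rewrite SigmapE pE.
under [X in _ = _ * (_ - X)]eq_bigr => k _.
  rewrite pE [_ * (W *m v) k 0]mulrC mulrCA; over.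
rewrite -mulr_sumr /GRing.scale/=.
by field.
Qed.

Lemma ploglin_coord_continuous r theta :
  {for theta, continuous (fun theta => ploglin W theta r 0)}.
Proof.
have e k : {for theta, continuous (fun th => expR ((W *m th) k 0))}.
  apply: (@continuous_comp _ _ _ (fun th : 'cV[R]_M0 => (W *m th) k 0)); last exact: continuous_expR.
  have -> : (fun th => (W *m th) k 0) = (fun th : 'cV[R]_M0 => \sum_j W k j * th j 0).
    by apply/funext => th; rewrite mxE.
  apply: continuous_for_sum => j; apply: continuous_forM.
    exact: continuous_for_cst.
  exact: coord_continuous.
have -> : (fun theta => ploglin W theta r 0) = (fun theta =>
    (\sum_k expR ((W *m theta) k 0))^-1 * expR ((W *m theta) r 0)).
  by apply/funext => th; exact: ploglinE.
apply: continuous_forM; last exact: e.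
apply: continuous_forV; first by rewrite gt_eqF// sum_expR_gt0.
exact: continuous_for_sum.
Qed.

Lemma ploglin_continuous theta : {for theta, continuous (ploglin W)}.
Proof.
apply: continuous_mx => i j; rewrite ord1.
exact: ploglin_coord_continuous.
Qed.

Lemma Sigmap_ploglin_continuous theta :
  {for theta, continuous (fun theta => Sigmap (ploglin W theta))}.
Proof.
apply: continuous_mx => i j.
have -> : (fun th => Sigmap (ploglin W th) i j) = (fun th => (i == j)%:R *
    ploglin W th i 0 - ploglin W th i 0 * ploglin W th j 0).
  by apply/funext => th; exact: Sigmap_entry.
apply: continuous_forB; apply: continuous_forM; try exact: ploglin_coord_continuous.
exact: continuous_for_cst.
Qed.

(** The mean value theorem on the segment gives, for each coordinate, the exact derivative at an
    intermediate point; continuity of [Sigmap (ploglin W theta)] in [theta] replaces that point by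
    [theta0]. *)
Lemma ploglin_expansion theta0 e : 0 < e -> exists2 d, 0 < d &
  forall h, `|h| < d -> `|ploglin W (theta0 + h) - ploglin W theta0
    - Sigmap (ploglin W theta0) *m W *m h| <= e * `|h|.
Proof.
move=> e0.
(* The two dimension factors come from two uses of [norm_mulmx]; the 1 only makes [K] positive. *)
pose K : R := M%:R * (M0%:R * `|W|) + 1.
have K0 : 0 < K by rewrite ltr_wpDl// !mulr_ge0.
have /cvgrPdist_le/(_ _ (divr_gt0 e0 K0))/nbhs_ballP[d d0 H] :=
  @Sigmap_ploglin_continuous theta0.
exists d => // h hd; apply: mxnorm_leP; first by rewrite mulr_ge0// ltW.
move=> r j; rewrite ord1 => {j}.
pose f t := ploglin W (theta0 + t *: h) r 0.
have fc : continuous f.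
  move=> t; apply: differentiable_continuous; apply/derivable1_diffP.
  by have [] := ploglin_line_derive theta0 h r t.
have [t] := @MVT R f _ 0 1 ltr01 (fun t _ => ploglin_line_derive theta0 h r t)
  (continuous_subspaceT fc).
rewrite in_itv/= => /andP[t0 t1]; rewrite /f scale1r scale0r addr0 subr0 mulr1 => ft.
rewrite !entryB -mulmxA ft -entryB -mulmxBl.
set S := _ - _.
have SK : `|S| <= e / K.
  rewrite /S distrC; apply: H; rewrite -ball_normE/= opprD addrA subrr sub0r normrN.
  rewrite normrZ gtr0_norm// (le_lt_trans _ hd)//.
  by rewrite -[leRHS]mul1r ler_wpM2r// ltW.
rewrite (le_trans (mxentry_le_norm _ _ _))// (le_trans (norm_mulmx _ _))//.
apply: (@le_trans _ _ (M%:R * (e / K) * (M0%:R * `|W| * `|h|))).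
  by rewrite ler_pM ?mulr_ge0 ?norm_mulmx// ler_wpM2l.
have -> : M%:R * (e / K) * (M0%:R * `|W| * `|h|) = e / K * (K - 1) * `|h|.
  by rewrite /K; ring.
rewrite ler_wpM2r// -mulrA ger_pMr// ler_pdivrMl// mulr1; lra.
Qed.
End loglinear.

(** * Identifiability and existence of the estimator *)

Section identifiability.
Variables (R : realType) (M M0 : nat) (W : 'M[R]_(M, M0)).
Hypothesis M_gt0 : (0 < M)%N.
Hypothesis W1_free : \rank (row_mx (const_mx 1 : 'cV[R]_M) W) = M0.+1.

(** A left inverse of the full-column-rank matrix [[1 W]], cut to its lower block: the first column
    of the identity gives [L 1 = 0], the others [L W = 1]. *)
Lemma design_left_inverse : exists2 L : 'M[R]_(M0, M),
  L *m (const_mx 1 : 'cV[R]_M) = 0 & L *m W = 1%:M.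
Proof.
have : row_free (row_mx (const_mx 1 : 'cV[R]_M) W)^T.
  by rewrite /row_free mxrank_tr W1_free.
move=> /row_freeP[B /(congr1 trmx)]; rewrite trmx_mul trmxK trmx1.
rewrite -[B^T]vsubmxK mul_col_row -[1%:M]submxK => /eq_block_mx[_ _ h1 h2].
exists (dsubmx B^T); first by rewrite h1 scalar_mx_block block_mxKdl.
by rewrite h2 scalar_mx_block block_mxKdr.
Qed.

(** The logarithm of [p(theta)] is [W theta] minus the log-normalizer times the constant vector, and
    [L] annihilates the latter. This explicit inverse is the identifiability of the model. *)
Lemma ploglin_inverse (L : 'M[R]_(M0, M)) theta :
  L *m (const_mx 1 : 'cV[R]_M) = 0 -> L *m W = 1%:M ->
  L *m map_mx (@ln R) (ploglin W theta) = theta.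
Proof.
move=> L1 LW.
have -> : map_mx (@ln R) (ploglin W theta) =
    W *m theta - ln (\sum_k expR ((W *m theta) k 0)) *: const_mx 1.
  apply/matrixP => i j; rewrite ord1 entryB [LHS]mxE ploglinE.
  rewrite lnM ?posrE ?invr_gt0 ?sum_expR_gt0 ?expR_gt0//.
  by rewrite lnV ?posrE ?sum_expR_gt0// expRK addrC !mxE mulr1.
by rewrite mulmxBr -scalemxAr L1 scaler0 subr0 mulmxA LW mul1mx.
Qed.

Lemma ploglin_inverse_continuous theta0 e : 0 < e -> exists2 d, 0 < d &
  forall theta, `|ploglin W theta - ploglin W theta0| < d -> `|theta - theta0| < e.
Proof.
move=> e0; have [L L1 LW] := design_left_inverse.
pose K : R := M%:R * `|L| + 1.
have K0 : 0 < K by rewrite ltr_wpDl// mulr_ge0.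
have lnc : {for ploglin W theta0, continuous (map_mx (@ln R) : 'cV[R]_M -> 'cV[R]_M)}.
  apply: continuous_mx => i j.
  have -> : (fun y => map_mx (@ln R) y i j) = (@ln R) \o (fun y : 'cV[R]_M => y i j).
    by apply/funext => y /=; rewrite mxE.
  apply: continuous_comp; first exact: coord_continuous.
  by apply: continuous_ln; rewrite ord1 ploglin_gt0.
have /cvgrPdist_lt/(_ _ (divr_gt0 e0 K0))/nbhs_ballP[d d0 H] := lnc.
exists d => // theta; rewrite distrC => td.
rewrite -(ploglin_inverse theta L1 LW) -(ploglin_inverse theta0 L1 LW) -mulmxBr.
rewrite (le_lt_trans (norm_mulmx _ _))// distrC.
have {}H : `|map_mx (@ln R) (ploglin W theta0) - map_mx (@ln R) (ploglin W theta)| < e / K.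
  by apply: H; rewrite -ball_normE.
apply: (@le_lt_trans _ _ (M%:R * `|L| * (e / K))).
  by rewrite ler_wpM2l ?mulr_ge0// ltW.
by rewrite mulrCA gtr_pMr// ltr_pdivrMr// mul1r ltrDl.
Qed.

(** For [v] in the kernel the quadratic form is the [p]-variance of [s = W v^T]. It vanishes, so [s]
    is constant because all weights are positive, and then [L s] is both 0 and [v^T]. *)
Lemma information_unit theta :
  W^T *m Sigmap (ploglin W theta) *m W \in unitmx.
Proof.
rewrite unitmxE unitfE; apply/negP => /det0P[v v0 vH].
set p := ploglin W theta in vH.
pose s := W *m v^T.
pose sb := \sum_k p k 0 * s k 0.
have E : \sum_r p r 0 * (s r 0 - sb) ^+ 2 = 0.
  have : (v *m (W^T *m Sigmap p *m W) *m v^T) 0 0 = 0 by rewrite vH mul0mx mxE.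
  have -> : v *m (W^T *m Sigmap p *m W) *m v^T = s^T *m (Sigmap p *m s).
    by rewrite /s trmx_mul trmxK !mulmxA.
  rewrite mxE => h; rewrite -[RHS]h.
  (* Centred values have mean zero under [p], so one factor [s] may be replaced by [s - sb]. *)
  have sb2 : \sum_r sb * (p r 0 * (s r 0 - sb)) = 0.
    rewrite -mulr_sumr; under eq_bigr do rewrite mulrBr.
    by rewrite sumrB -/sb -mulr_suml (sum_ploglin W M_gt0) mul1r subrr mulr0.
  transitivity (\sum_r s r 0 * (p r 0 * (s r 0 - sb)) - \sum_r sb * (p r 0 * (s r 0 - sb))).
    by rewrite -sumrB; apply: eq_bigr => r _; ring.
  by rewrite sb2 subr0; apply: eq_bigr => r _; rewrite SigmapE [s^T _ _]mxE.
have sE : s = sb *: const_mx 1.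
  apply/matrixP => r j; rewrite ord1 !mxE mulr1.
  have ge0 i : true -> 0 <= p i 0 * (s i 0 - sb) ^+ 2.
    by move=> _; rewrite mulr_ge0 ?sqr_ge0// ltW// (ploglin_gt0 _ M_gt0).
  move/eqP: E; rewrite psumr_eq0// => /allP/(_ r (mem_index_enum _))/=.
  rewrite mulf_eq0 (gt_eqF (ploglin_gt0 _ M_gt0 _ _))/= sqrf_eq0 subr_eq0.
  by rewrite [s r 0]mxE => /eqP.
have [L L1 LW] := design_left_inverse.
have : L *m s = v^T by rewrite /s mulmxA LW mul1mx.
rewrite sE -scalemxAr L1 scaler0 => /(congr1 trmx); rewrite trmxK trmx0 => v0'.
by rewrite -v0' eqxx in v0.
Qed.

End identifiability.

(** * Coercivity of the divergence and existence of a minimizer *)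

Section divergence.
Variables (R : realType) (M M0 : nat) (W : 'M[R]_(M, M0)) (phi : R -> R).
Hypothesis M_gt0 : (0 < M)%N.
Hypothesis W1_free : \rank (row_mx (const_mx 1 : 'cV[R]_M) W) = M0.+1.
Hypothesis phia : admissible phi.
Variable theta0 : 'cV[R]_M0.
Local Notation p0 := (ploglin W theta0).
Implicit Types (p : 'cV[R]_M) (theta : 'cV[R]_M0).

(** Real-valued form of [dphi] against the model, agreeing with it where [p] has positive entries,
    since every summand then falls in the first branch of [phi_term]. *)
Definition phi_div (p : 'cV[R]_M) (theta : 'cV[R]_M0) : R :=
  \sum_r ploglin W theta r 0 * phi (p r 0 / ploglin W theta r 0).

Lemma dphi_phi_div p theta : (forall r, 0 < p r 0) ->
  dphi phi p (ploglin W theta) = (phi_div p theta)%:E.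
Proof.
move=> p_gt0; rewrite /dphi /phi_div -sumEFin; apply: eq_bigr => r _.
by rewrite /phi_term (ploglin_gt0 _ M_gt0) p_gt0.
Qed.

Lemma p0_lower_bound : exists2 m : R, 0 < m & forall r, m <= p0 r 0.
Proof.
(* The reciprocal of the sum of reciprocals lies below every entry. *)
pose S := \sum_r (p0 r 0)^-1.
have S0 r : (p0 r 0)^-1 <= S.
  rewrite /S (bigD1 r)//= lerDl; apply: sumr_ge0 => k _.
  by rewrite invr_ge0 ltW// ploglin_gt0.
have SM : 0 < S.
  by apply: lt_le_trans (S0 (Ordinal M_gt0)); rewrite invr_gt0 ploglin_gt0.
exists S^-1; first by rewrite invr_gt0.
by move=> r; rewrite invf_ple ?posrE ?ploglin_gt0.
Qed.

Lemma phi_div_term_continuous (T : topologicalType) (a b : T -> R) x : 0 < a x -> 0 < b x ->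
  {for x, continuous a} -> {for x, continuous b} ->
  {for x, continuous (fun y => b y * phi (a y / b y))}.
Proof.
move=> a0 b0 ca cb; apply: continuous_forM => //.
apply: (@continuous_comp _ _ _ (fun y => a y / b y)).
  by apply: continuous_forM => //; apply: continuous_forV; rewrite // gt_eqF.
by apply: phi_continuous => //; rewrite divr_gt0.
Qed.

Lemma phi_div_continuous p theta : (forall r, 0 < p r 0) ->
  {for theta, continuous (phi_div p)}.
Proof.
move=> p_gt0; apply: continuous_for_sum => r.
apply: phi_div_term_continuous => //; first exact: ploglin_gt0.
  exact: continuous_for_cst.
exact: ploglin_coord_continuous.
Qed.

Lemma phi_div_p0_continuous : {for p0, continuous (phi_div^~ theta0)}.
Proof.
apply: continuous_for_sum => r.
apply: (@phi_div_term_continuous _ (fun p : 'cV[R]_M => p r 0) (fun=> p0 r 0));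
  rewrite ?ploglin_gt0//.
  exact: coord_continuous.
exact: continuous_for_cst.
Qed.

(** If [theta] is at distance [e] from [theta0], then [q = p(theta)] is at distance [g] from [p0],
    and [p] is within [g/4] of [p0], so the entries of [p - q] sum in absolute value to at least
    [3g/4]. As [q] has mass one, linear growth with slack [g/4] gives a divergence of at least
    [k g/2], whereas at [theta0] it is below [k g/2] by continuity from the value 0. *)
Lemma phi_div_separated e : 0 < e -> exists2 d, 0 < d & forall p theta,
  (forall r, 0 < p r 0) -> `|p - p0| < d -> e <= `|theta - theta0| ->
  phi_div p theta0 < phi_div p theta.
Proof.
move=> e0; have [g g0 Hg] := ploglin_inverse_continuous M_gt0 W1_free theta0 e0.
have [k k0 Hk] := phi_ge_linear phia (divr_gt0 g0 (ltr0Sn _ 3)).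
have kg : 0 < k * (g / 2) by rewrite mulr_gt0// divr_gt0.
have /cvgrPdist_lt/(_ _ kg)/nbhs_ballP[d d0 Hd] := phi_div_p0_continuous.
exists (Num.min d (g / 4)); first by rewrite lt_min d0 divr_gt0.
move=> p theta p_gt0; rewrite lt_min => /andP[pd pg] te.
have p0E : phi_div p0 theta0 = 0.
  rewrite /phi_div big1// => r _; rewrite divff ?gt_eqF ?ploglin_gt0//.
  by have [_ _ -> _ _] := phia; rewrite mulr0.
have h0 : phi_div p theta0 < k * (g / 2).
  have := Hd p; rewrite p0E sub0r normrN => Hp; apply: le_lt_trans (Hp _).
    exact: ler_norm.
  by rewrite -ball_normE/= distrC.
apply: (lt_le_trans h0).
set q := ploglin W theta.
have qg : g <= `|q - p0| by rewrite leNgt; apply/negP => /Hg; rewrite ltNge te.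
have pq : 3 * (g / 4) <= \sum_r `|p r 0 - q r 0|.
  have : `|p - q| <= \sum_r `|p r 0 - q r 0|.
    apply: mxnorm_leP; first exact: sumr_ge0.
    by move=> i j; rewrite ord1 entryB (bigD1 i)//= lerDl sumr_ge0.
  apply: le_trans.
  have : `|q - p0| <= `|p - q| + `|p - p0|.
    by rewrite [`|p - q|]distrC -[q - p0](subrKA p); exact: ler_normD.
  by move: qg pg; move: `|q - p0| `|p - q| `|p - p0| => x y z; lra.
have : k * (\sum_r `|p r 0 - q r 0| - g / 4) <= phi_div p theta.
  have qE : \sum_r q r 0 * (g / 4) = g / 4.
    by rewrite -mulr_suml (sum_ploglin W M_gt0) mul1r.
  rewrite -[X in _ - X]qE -sumrB mulr_sumr.
  apply: ler_sum => r _; rewrite -/q.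
  have q0 : 0 < q r 0 by exact: ploglin_gt0.
  have -> : k * (`|p r 0 - q r 0| - q r 0 * (g / 4)) =
      q r 0 * (k * (`|p r 0 / q r 0 - 1| - g / 4)).
    have -> : p r 0 - q r 0 = q r 0 * (p r 0 / q r 0 - 1) by field; rewrite gt_eqF.
    by rewrite normrM gtr0_norm//; ring.
  by rewrite ler_pM2l//; apply: Hk; rewrite divr_gt0.
by apply: le_trans; rewrite ler_pM2l//; lra.
Qed.

(** A minimum over the unit cube around [theta0] is global, because outside the cube the value
    already exceeds that at [theta0]. *)
Lemma phi_div_min_exists : exists2 d, 0 < d & forall p, (forall r, 0 < p r 0) ->
  `|p - p0| < d -> exists theta, forall theta', phi_div p theta <= phi_div p theta'.
Proof.
have [d d0 H] := phi_div_separated ltr01; exists d => // p p_gt0 pd.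
(* The cube is written with row vectors, the form of [rV_compact], and transposed back. *)
pose A := [set v : 'rV[R]_M0 | forall i, `[theta0 i 0 - 1, theta0 i 0 + 1]%classic (v ord0 i)].
have cA : compact A.
  apply: (@rV_compact _ _ (fun i => `[theta0 i 0 - 1, theta0 i 0 + 1]%classic)) => i.
  exact: segment_compact.
have A0 : A !=set0.
  by exists theta0^T => i /=; rewrite mxE in_itv/=; apply/andP; split; lra.
have cD : continuous (phi_div p \o trmx).
  move=> v; apply: continuous_comp; last exact: phi_div_continuous.
  apply: continuous_mx => i j.
  rewrite (_ : (fun y => _) = (fun y : 'rV[R]_M0 => y j i)).
    exact: coord_continuous.
  by apply/funext => y; rewrite mxE.
have [v _ vm] := compact_EVT_min A0 cA (continuous_subspaceT cD).
exists v^T => theta.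
have le1 th : `|th - theta0| <= 1 -> phi_div p v^T <= phi_div p th.
  move=> th1; have := vm th^T; rewrite /= trmxK; apply; rewrite inE => i /=.
  rewrite mxE in_itv/=.
  have := le_trans (mxentry_le_norm (th - theta0) i 0) th1.
  by rewrite entryB ler_norml => /andP[]; lra.
have [/le1//|t1] := leP `|theta - theta0| 1.
apply: le_trans (ltW (H p theta p_gt0 pd (ltW t1))).
by apply: le1; rewrite subrr normr0.
Qed.

End divergence.

(** * Linearization of the residual *)

Section stationarity.
Variables (R : realType) (M M0 : nat) (W : 'M[R]_(M, M0)) (phi : R -> R).
Hypothesis M_gt0 : (0 < M)%N.
Hypothesis W1_free : \rank (row_mx (const_mx 1 : 'cV[R]_M) W) = M0.+1.
Hypothesis phia : admissible phi.
Variable theta0 : 'cV[R]_M0.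
Implicit Types (p : 'cV[R]_M) (theta : 'cV[R]_M0).
Local Notation p0 := (ploglin W theta0).
Local Notation c := (derive1 (derive1 phi) 1).
Local Notation S := (Sigmap p0).
Local Notation H := (W^T *m S *m W).
Local Notation phi_div := (phi_div W phi).

Lemma phi_div_term_derive (q : R -> R) (a t dq : R) : 0 < a -> 0 < q t ->
  is_derive t 1 q dq ->
  is_derive t 1 (fun u => q u * phi (a / q u))
    ((phi (a / q t) - a / q t * derive1 phi (a / q t)) * dq).
Proof.
move=> a0 q0 dqt; have [_ phid _ _ _] := phia.
have [d1 _ _] := phid (a / q t) (divr_gt0 a0 q0).
have dphi : is_derive (a / q t) 1 phi (derive1 phi (a / q t)).
  by rewrite derive1E; exact: derivableP.
have q0' : q t != 0 by rewrite gt_eqF.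
have dV := is_deriveZ a (is_deriveV q0' dqt).
have dc := @is_derive1_comp R phi (a *: (fun y => (q y)^-1)) t _ _ dphi dV.
have dM := is_deriveM dqt dc.
apply: (@is_derive_eq _ _ _ _ _ _ _ _ dM).
rewrite /GRing.scale/=.
by field.
Qed.

Lemma stationary p theta (v : 'cV[R]_M0) : (forall r, 0 < p r 0) ->
  (forall theta', phi_div p theta <= phi_div p theta') ->
  \sum_r (phi (p r 0 / ploglin W theta r 0) -
      p r 0 / ploglin W theta r 0 * derive1 phi (p r 0 / ploglin W theta r 0)) *
    (Sigmap (ploglin W theta) *m (W *m v)) r 0 = 0.
Proof.
move=> p_gt0 pmin.
pose f r (t : R) := ploglin W (theta + t *: v) r 0 *
  phi (p r 0 / ploglin W (theta + t *: v) r 0).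
have df (t : R) : is_derive t 1 (\sum_r f r)
    (\sum_r (phi (p r 0 / ploglin W (theta + t *: v) r 0) -
      p r 0 / ploglin W (theta + t *: v) r 0 *
      derive1 phi (p r 0 / ploglin W (theta + t *: v) r 0)) *
    (Sigmap (ploglin W (theta + t *: v)) *m (W *m v)) r 0).
  apply: is_derive_sum => r.
  apply: (@phi_div_term_derive (fun t => ploglin W (theta + t *: v) r 0)) => //.
    exact: ploglin_gt0.
  exact: ploglin_line_derive.
have fE t : (\sum_r f r) t = phi_div p (theta + t *: v) by rewrite fct_sumE.
(* Fermat's rule: [t = 0] is an interior minimum on the interval from -1 to 1. *)
have d0 : is_derive (0 : R) 1 (\sum_r f r) 0.
  apply: (@derive1_at_min _ _ (-1) 1); first lra.
  - by move=> t _; case: (df t).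
  - by rewrite in_itv/=; apply/andP; split; lra.
  - by move=> t _; rewrite !fE scale0r addr0.
have [_ e1] := df 0; have [_ e2] := d0.
by move: e1; rewrite e2 scale0r addr0 => <-.
Qed.

(** Substituting the score expansion into stationarity, the linear part is exactly
    [-c (p - q)^T (s - sb)]. Since [p] and [q] both have mass one, [sb] disappears and
    [c W^T (p - q)] equals a sum of remainders, each small relative to [p - q]. *)
Lemma score_small e : 0 < e -> exists2 d, 0 < d & forall p theta,
  \sum_r p r 0 = 1 -> (forall r, 0 < p r 0) ->
  `|p - p0| < d -> `|ploglin W theta - p0| < d ->
  (forall theta', phi_div p theta <= phi_div p theta') ->
  `|W^T *m (p - ploglin W theta)| <= e * `|p - ploglin W theta|.
Proof.
move=> e0; have [_ _ _ _ c0] := phia.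
have [m m0 Hm] := p0_lower_bound W M_gt0 theta0.
(* There are [M] summands, each with a factor [|s r - sb| <= 2 |W|]. *)
pose K : R := 2 * (M%:R * `|W|) + 1.
have K0 : 0 < K by rewrite ltr_wpDl// !mulr_ge0.
have eK : 0 < c * e / K by rewrite divr_gt0// mulr_gt0.
have [b b0 Hb] := phi_score_expansion phia eK.
(* The first bound keeps [q >= m/2]; the second gives [|p - q| < b m / 2], hence
   [|p r / q r - 1| < b]. *)
exists (Num.min (m / 2) (b * m / 4)).
  by rewrite lt_min !divr_gt0// mulr_gt0.
move=> p theta sp p_gt0; set q := ploglin W theta.
rewrite !lt_min => /andP[pm pb] /andP[qm qb] pmin.
have q0 r : 0 < q r 0 by exact: ploglin_gt0.
have sq : \sum_r q r 0 = 1 by exact: sum_ploglin.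
have qm2 r : m / 2 <= q r 0.
  have := le_lt_trans (mxentry_le_norm (q - p0) r 0) qm.
  rewrite entryB ltr_norml => /andP[+ _]; move: (q r 0) (p0 r 0) (Hm r) => x y; lra.
have ub r : `|p r 0 / q r 0 - 1| < b.
  have -> : p r 0 / q r 0 - 1 = (p r 0 - q r 0) / q r 0.
    by field; rewrite gt_eqF.
  rewrite normrM normfV (gtr0_norm (q0 r)) ltr_pdivrMr//.
  apply: (@lt_le_trans _ _ (b * (m / 2))); last by rewrite ler_pM2l.
  rewrite -entryB; apply: le_lt_trans (mxentry_le_norm _ _ _) _.
  have : `|p - q| <= `|p - p0| + `|q - p0|.
    by rewrite -[p - q](subrKA p0) [`|q - p0|]distrC; exact: ler_normD.
  by move: pb qb; move: `|p - p0| `|p - q| `|q - p0| => x y z; lra.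
apply: mxnorm_leP; first by rewrite mulr_ge0// ltW.
move=> k j; rewrite ord1 => {j}.
(* The direction of the [k]-th parameter, so [s] is the [k]-th column of [W]. *)
pose s : 'cV[R]_M := W *m delta_mx k 0.
have sE r : s r 0 = W r k by rewrite /s -colE mxE.
have := stationary (delta_mx k 0) p_gt0 pmin.
rewrite -/q -/s.
pose rho r := phi (p r 0 / q r 0) - p r 0 / q r 0 * derive1 phi (p r 0 / q r 0)
  + c * (p r 0 / q r 0 - 1).
pose sb := \sum_k q k 0 * s k 0.
have rb r : `|rho r * q r 0| <= c * e / K * `|(p - q) r 0|.
  rewrite normrM (gtr0_norm (q0 r)) entryB.
  have -> : p r 0 - q r 0 = (p r 0 / q r 0 - 1) * q r 0.
    by field; rewrite gt_eqF.
  by rewrite normrM (gtr0_norm (q0 r)) mulrA ler_pM2r//; exact: Hb.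
under eq_bigr => r _.
  rewrite SigmapE -/sb.
  rewrite (_ : _ * _ = rho r * q r 0 * (s r 0 - sb) - c * ((p - q) r 0 * s r 0)
     + c * sb * (p r 0 - q r 0)); last first.
    by rewrite entryB /rho; field; rewrite gt_eqF.
  over.
rewrite big_split/= sumrB -!mulr_sumr sumrB sp sq subrr mulr0 addr0.
move=> /eqP; rewrite subr_eq0 => /eqP rs.
have -> : (W^T *m (p - q)) k 0 = \sum_r (p - q) r 0 * s r 0.
  by rewrite mxE; apply: eq_bigr => r _; rewrite mxE sE mulrC.
rewrite -(ler_pM2l c0) -{1}(gtr0_norm c0) -normrM -rs.
apply: le_trans (ler_norm_sum _ _ _) _.
have sb2 r : `|s r 0 - sb| <= 2 * `|W|.
  apply: le_trans (ler_normB _ _) _.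
  have -> : 2 * `|W| = `|W| + `|W| by ring.
  apply: lerD; first by rewrite sE mxentry_le_norm.
  rewrite /sb (le_trans (ler_norm_sum _ _ _))//.
  rewrite -[leRHS]mul1r -sq mulr_suml; apply: ler_sum => i _.
  by rewrite normrM (gtr0_norm (q0 i)) ler_pM2l// sE mxentry_le_norm.
apply: (@le_trans _ _ (\sum_(r < M) c * e / K * `|p - q| * (2 * `|W|))).
  apply: ler_sum => r _; rewrite normrM ler_pM//.
  by apply: le_trans (rb r) _; rewrite ler_pM2l// mxentry_le_norm.
rewrite sumr_const card_ord -[_ *+ M]mulr_natl.
have -> : M%:R * (c * e / K * `|p - q| * (2 * `|W|)) = c * (e * `|p - q|) * ((K - 1) / K).
  by rewrite /K; ring.
apply: ler_piMr; first by rewrite mulr_ge0 ?(ltW c0)// mulr_ge0// ltW.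
by rewrite ler_pdivrMr// mul1r gerBl.
Qed.

(** Scalar bookkeeping for [residual_expansion]: [x], [h], [y] are the sizes of [p - p0],
    [theta - theta0], [p - q]; [r] is the Taylor remainder, [w] the size of [W^T (p - q)], [z] the
    linearization error. The bounds are circular, as [h] is controlled by [r] and [w], and these by
    [h] and [y]. Smallness of [e] makes the returning share at most [h/2], whence [h <= 4 C x]. *)
Lemma absorb_remainder (C e x h y r w z : R) : 1 <= C -> 0 <= e <= 1 ->
  e * (C + C * (C + 1)) <= 2^-1 -> 0 <= x -> 0 <= h ->
  r <= e * h -> w <= e * y -> h <= C * (x + r + w) -> y <= x + C * h + r ->
  z <= C * (r + w) ->
  z <= e * (C * (4 * C + (1 + (C + 1) * (4 * C)))) * x.
Proof.
move=> C1 /andP[e0 e1] eC x0 h0 rh wy hb yb zb.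
have C0 : 0 <= C by lra.
have rh' : r <= h by apply: le_trans rh _; rewrite ler_piMl.
have yb' : y <= x + (C + 1) * h by rewrite mulrDl mul1r; lra.
have wb : w <= e * (x + (C + 1) * h) by apply: le_trans wy _; rewrite ler_wpM2l.
have hb2 : h <= C * (x + e * h + e * (x + (C + 1) * h)).
  by apply: le_trans hb _; rewrite ler_wpM2l//; lra.
have E1 : C * (x + e * h + e * (x + (C + 1) * h)) =
  C * x + e * (C * x) + e * (C + C * (C + 1)) * h by ring.
have E2 : e * (C * x) <= C * x by rewrite ler_piMl// mulr_ge0.
have E3 : e * (C + C * (C + 1)) * h <= 2^-1 * h by rewrite ler_wpM2r.
have h4 : h <= 4 * C * x.
  rewrite E1 in hb2; rewrite -mulrA; move: (C * x) E2 hb2 => cx.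
  by move: (e * (C + C * (C + 1)) * h) E3 (e * cx) => a E3 b; lra.
have y4 : y <= (1 + (C + 1) * (4 * C)) * x.
  apply: le_trans yb' _; rewrite [leRHS]mulrDl mul1r lerD2l -mulrA.
  by apply: ler_wpM2l => //; lra.
have r4 : r <= e * (4 * C * x) by apply: le_trans rh _; rewrite ler_wpM2l.
have w4 : w <= e * ((1 + (C + 1) * (4 * C)) * x) by apply: le_trans wy _; rewrite ler_wpM2l.
apply: le_trans zb _.
have -> : e * (C * (4 * C + (1 + (C + 1) * (4 * C)))) * x =
  C * (e * (4 * C * x) + e * ((1 + (C + 1) * (4 * C)) * x)) by ring.
by rewrite ler_wpM2l// lerD.
Qed.

(** For invertible [H] this is the oblique projector onto the kernel of [W^T] along the range of
    [S W], the tangent space of the model at [p0]. *)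
Definition residual_mx : 'M[R]_M := 1%:M - S *m W *m invmx H *m W^T.

(** Existence is part of the conclusion because the estimator is only assumed to minimize where a
    minimizer exists; the estimate covers every minimizer because there may be several. *)
Lemma residual_expansion e : 0 < e -> exists2 d, 0 < d & forall p,
  \sum_r p r 0 = 1 -> `|p - p0| < d ->
  [/\ forall r, 0 < p r 0,
      exists theta, forall theta', phi_div p theta <= phi_div p theta' &
      forall theta, (forall theta', phi_div p theta <= phi_div p theta') ->
        `|p - ploglin W theta - residual_mx *m (p - p0)| <= e * `|p - p0|].
Proof.
move=> e0.
have Hu := information_unit M_gt0 W1_free theta0.
pose Hi := invmx H.
have HiH : Hi *m H = 1%:M by exact: mulVmx.
have HiE : residual_mx = 1%:M - S *m W *m Hi *m W^T by [].
pose a1 : R := M%:R * `|Hi *m W^T|.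
pose a2 : R := M0%:R * `|Hi|.
pose a3 : R := M0%:R * `|S *m W|.
pose a4 : R := M%:R * `|S *m W *m Hi *m W^T|.
pose a5 : R := M0%:R * `|S *m W *m Hi|.
(* Dominates the [norm_mulmx] constant of every matrix in [hE], [yE] and [zE]; the 1 also covers the
   bare [- r] in [zE]. *)
pose C : R := 1 + a1 + a2 + a3 + a4 + a5.
have a0 : [/\ 0 <= a1, 0 <= a2, 0 <= a3, 0 <= a4 & 0 <= a5].
  by split; exact: mulr_ge0.
have C1 : 1 <= C by case: a0 => *; rewrite /C; lra.
have C0 : 0 < C by lra.
pose K : R := C * (4 * C + (1 + (C + 1) * (4 * C))).
have C4 : 0 < 4 * C by rewrite mulr_gt0.
have K0 : 0 < K by rewrite /K mulr_gt0// addr_gt0// addr_gt0// mulr_gt0// addr_gt0.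
pose J : R := C + C * (C + 1).
have J0 : 0 < J by rewrite /J addr_gt0// mulr_gt0// addr_gt0.
pose b := Num.min 1 (Num.min (2^-1 / J) (e / K)).
have b0 : 0 < b by rewrite !lt_min ltr01 !divr_gt0// invr_gt0.
have b1 : b <= 1 by rewrite ge_min lexx.
have bJ : b * J <= 2^-1 by rewrite -ler_pdivlMr// !ge_min lexx orbT.
have bK : b * K <= e by rewrite -ler_pdivlMr// !ge_min lexx !orbT.
have [d1 d10 H1] := ploglin_expansion W M_gt0 theta0 b0.
have [d2 d20 H2] := score_small b0.
have /cvgrPdist_lt/(_ _ d20)/nbhs_ballP[d3 /= d30 H3] := @ploglin_continuous R M M0 W M_gt0 theta0.
have d4 : 0 < Num.min d1 d3 by rewrite lt_min d10.
(* Within [d5] a minimizer must lie close to [theta0], since otherwise [theta0] would do strictly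
   better. *)
have [d5 d50 H5] := phi_div_separated M_gt0 W1_free phia theta0 d4.
have [d6 d60 H6] := phi_div_min_exists M_gt0 W1_free phia theta0.
have [m m0 Hm] := p0_lower_bound W M_gt0 theta0.
exists (Num.min (Num.min d2 d5) (Num.min d6 m)); first by rewrite !lt_min d20 d50 d60.
move=> p sp; rewrite !lt_min => /andP[/andP[pd2 pd5] /andP[pd6 pm]].
have p_gt0 r : 0 < p r 0.
  have := le_lt_trans (mxentry_le_norm (p - p0) r 0) pm.
  by rewrite entryB ltr_norml => /andP[+ _]; move: (p r 0) (p0 r 0) (Hm r) => x y; lra.
split => //; first exact: H6.
move=> theta tmin.
have td : `|theta - theta0| < Num.min d1 d3.
  by rewrite ltNge; apply/negP => /(H5 p theta p_gt0 pd5); rewrite ltNge tmin.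
move: td; rewrite lt_min => /andP[td1 td3].
have qd2 : `|ploglin W theta - p0| < d2.
  by rewrite distrC; apply: H3; rewrite -ball_normE/= distrC.
have := H2 p theta sp p_gt0 pd2 qd2 tmin.
have := H1 (theta - theta0) td1.
rewrite [theta0 + _]addrC subrK.
set q := ploglin W theta; set h := theta - theta0.
set r := _ - _ *m h; set x := p - p0.
move=> rb wb.
have yE : p - q = x - S *m W *m h - r by rewrite /r /x; apply/matrixP => i j; rewrite !entryB; ring.
clearbody x r h Hi.
(* Applying [Hi W^T] to [yE] solves it for [h]; the term in [W^T (p - q)] is the one made small by
   [score_small]. *)
have hE : h = Hi *m W^T *m (x - r) - Hi *m (W^T *m (p - q)).
  have E : Hi *m (W^T *m (S *m (W *m h))) = h.
    by rewrite !mulmxA -(mulmxA Hi) -(mulmxA Hi) HiH mul1mx.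
  rewrite yE !mulmxBr -!mulmxA E.
  by apply/matrixP => i j; rewrite !entryB; ring.
have zE : p - q - residual_mx *m x =
    S *m W *m Hi *m (W^T *m (p - q)) + (S *m W *m Hi *m W^T *m r - r).
  rewrite HiE mulmxBl mul1mx {1}yE {1}hE !mulmxBr !mulmxA.
  by apply/matrixP => i j; rewrite !(entryB, mxE); ring.
have B n' (A : 'M[R]_(n', M)) (z : 'cV_M) : `|A *m z| <= M%:R * `|A| * `|z| := norm_mulmx A z.
have B0 n' (A : 'M[R]_(n', M0)) (z : 'cV_M0) : `|A *m z| <= M0%:R * `|A| * `|z| := norm_mulmx A z.
case: a0 => p1 p2 p3 p4 p5.
apply: le_trans (_ : b * K * `|x| <= _); last by rewrite ler_wpM2r.
have leC (a t : R) : a <= C -> 0 <= t -> a * t <= C * t by move=> aC t0; rewrite ler_wpM2r.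
apply: (@absorb_remainder C b `|x| `|h| `|p - q| `|r| `|W^T *m (p - q)|) => //.
- by rewrite (ltW b0).
- rewrite {1}hE; apply: le_trans (ler_normB _ _) _.
  apply: le_trans (lerD (B _ _ _) (B0 _ _ _)) _.
  rewrite -/a1 -/a2 mulrDr; apply: lerD; last by apply: leC => //; rewrite /C; lra.
  apply: (@le_trans _ _ (a1 * (`|x| + `|r|))).
    by apply: ler_wpM2l => //; exact: ler_normB.
  by apply: leC; rewrite ?addr_ge0// /C; lra.
- rewrite {1}yE; apply: le_trans (ler_normB _ _) _; rewrite lerD2r.
  apply: le_trans (ler_normB _ _) _; rewrite lerD2l.
  by apply: le_trans (B0 _ _ _) _; rewrite -/a3; apply: leC => //; rewrite /C; lra.
- rewrite zE; apply: le_trans (ler_normD _ _) _.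
  rewrite mulrDr addrC; apply: lerD.
    apply: le_trans (ler_normB _ _) _; apply: le_trans (lerD (B _ _ _) (lexx _)) _.
    by rewrite -/a4 -{2}[`|r|]mul1r -mulrDl; apply: leC => //; rewrite /C; lra.
  by apply: le_trans (B0 _ _ _) _; rewrite -/a5; apply: leC => //; rewrite /C; lra.
Qed.

End stationarity.

(** * Bernstein and trigonometric polynomials *)

Section bernstein_weights.
Variable R : realType.
Implicit Types (s : R) (g : nat -> R).

(* The binomial weight C(n, k) s^k (1 - s)^(n - k), through Pascal's rule. *)
Fixpoint bern (n k : nat) (s : R) : R :=
  match n, k with
  | 0%N, 0%N => 1
  | 0%N, _.+1 => 0
  | n'.+1, 0%N => (1 - s) * bern n' 0 s
  | n'.+1, k'.+1 => s * bern n' k' s + (1 - s) * bern n' k'.+1 s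
  end.

Lemma bern_ge0 n k s : 0 <= s <= 1 -> 0 <= bern n k s.
Proof.
move=> /andP[s0 s1]; elim: n k => [[|k]|n ih [|k]] //=.
  by rewrite mulr_ge0// subr_ge0.
by rewrite addr_ge0// mulr_ge0// subr_ge0.
Qed.

Lemma bern_gt n k s : (n < k)%N -> bern n k s = 0.
Proof.
elim: n k => [[|k]|n ih [|k]] //= nk.
by rewrite !ih ?mulr0 ?addr0// ltnW.
Qed.

(** Conditioning on one of [n + 1] Bernoulli trials: a success shifts [g], a failure leaves it. The
    mass and the second moment then follow by induction. *)
Lemma sum_bernS n g s : \sum_(k < n.+2) g k * bern n.+1 k s =
  s * \sum_(k < n.+1) g k.+1 * bern n k s + (1 - s) * \sum_(k < n.+1) g k * bern n k s.
Proof.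
rewrite big_ord_recl /=.
under eq_bigr do rewrite /bump /= add1n mulrDr.
rewrite big_split/= [X in _ + (X + _) = _](_ : _ = s * \sum_(k < n.+1) g k.+1 * bern n k s); last first.
  by rewrite mulr_sumr; apply: eq_bigr => k _; ring.
rewrite addrCA; congr (_ + _).
rewrite mulr_sumr [RHS]big_ord_recl/= [in LHS]big_ord_recr/= (@bern_gt n n.+1)// !mulr0 addr0.
congr (_ + _); first by ring.
by apply: eq_bigr => k _; rewrite /bump/= add1n; ring.
Qed.

Lemma sum_bern n s : \sum_(k < n.+1) bern n k s = 1.
Proof.
elim: n => [|n ih]; first by rewrite big_ord1.
have := sum_bernS n (fun=> 1) s.
under eq_bigr do rewrite mul1r.
by under [X in _ = s * X + _]eq_bigr do rewrite mul1r;
  under [X in _ = _ + _ * X]eq_bigr do rewrite mul1r; rewrite ih => ->; ring.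
Qed.

(** The centre [c] is arbitrary because the shift in [sum_bernS] turns it into [c - 1] during the
    induction. *)
Lemma bern_variance n s (c : R) : \sum_(k < n.+1) (k%:R - c) ^+ 2 * bern n k s =
  n%:R * s * (1 - s) + (n%:R * s - c) ^+ 2.
Proof.
elim: n c => [|n ih] c; first by rewrite big_ord1/=; ring.
rewrite (sum_bernS n (fun k => (k%:R - c) ^+ 2)) ih.
under eq_bigr => k _.
  rewrite -natr1 (_ : k%:R + 1 - c = k%:R - (c - 1)); last by ring.
  over.
by rewrite ih -natr1; ring.
Qed.

End bernstein_weights.

Section trig_polynomials.
Variables (R : realType) (M : nat).
Implicit Types (t x : 'cV[R]_M) (f g : 'cV[R]_M -> R).

Definition dot t x : R := (t^T *m x) 0 0.

Lemma dotE t x : dot t x = \sum_i t i 0 * x i 0.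
Proof. by rewrite /dot mxE; apply: eq_bigr => i _; rewrite mxE. Qed.

Lemma dotDl t u x : dot (t + u) x = dot t x + dot u x.
Proof. by rewrite /dot linearD/= mulmxDl mxE. Qed.

Lemma dotBl t u x : dot (t - u) x = dot t x - dot u x.
Proof. by rewrite /dot linearB/= mulmxBl entryB. Qed.

(** Only the linear span of cosines and sines is generated, so convergence of characteristic
    functions extends to it by induction; closure under products is derived in [trig_mul] from the
    product-to-sum formulas. *)
Inductive trig_poly : ('cV[R]_M -> R) -> Prop :=
| trig_cos t : trig_poly (fun x => cos (dot t x))
| trig_sin t : trig_poly (fun x => sin (dot t x))
| trig_add f g : trig_poly f -> trig_poly g -> trig_poly (fun x => f x + g x)
| trig_scale a f : trig_poly f -> trig_poly (fun x => a * f x).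

Lemma trig_poly_ext f g : f =1 g -> trig_poly f -> trig_poly g.
Proof. by move=> /funext ->. Qed.

Lemma trig_cst a : trig_poly (fun=> a).
Proof.
apply: trig_poly_ext (trig_scale a (trig_cos 0)) => x.
by rewrite dotE big1 ?cos0 ?mulr1// => i _; rewrite mxE mul0r.
Qed.

Lemma trig_sum (I : Type) (r : seq I) (F : I -> 'cV[R]_M -> R) :
  (forall i, trig_poly (F i)) -> trig_poly (fun x => \sum_(i <- r) F i x).
Proof.
move=> tF; elim: r => [|i r ih].
  by apply: trig_poly_ext (trig_cst 0) => x; rewrite big_nil.
by apply: trig_poly_ext (trig_add (tF i) ih) => x; rewrite big_cons.
Qed.

Lemma trig_mul f g : trig_poly f -> trig_poly g -> trig_poly (fun x => f x * g x).
Proof.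
move=> tf tg; elim: tf => {f} [t|t|f f' _ h _ h'|a f _ h].
- elim: tg => {g} [u|u|g g' _ h _ h'|a g _ h].
  + apply: trig_poly_ext (trig_scale 2^-1 (trig_add (trig_cos (t + u)) (trig_cos (t - u)))) => x.
    by rewrite dotBl dotDl cosB cosD; field.
  + apply: trig_poly_ext (trig_scale 2^-1 (trig_add (trig_sin (t + u)) (trig_sin (u - t)))) => x.
    by rewrite dotBl dotDl sinB sinD; field.
  + by apply: trig_poly_ext (trig_add h h') => x; ring.
  + by apply: trig_poly_ext (trig_scale a h) => x; ring.
- elim: tg => {g} [u|u|g g' _ h _ h'|a g _ h].
  + apply: trig_poly_ext (trig_scale 2^-1 (trig_add (trig_sin (t + u)) (trig_sin (t - u)))) => x.
    by rewrite dotBl dotDl sinB sinD; field.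
  + apply: trig_poly_ext (trig_scale 2^-1 (trig_add (trig_cos (t - u))
      (trig_scale (-1) (trig_cos (t + u))))) => x.
    by rewrite dotBl dotDl cosB cosD; field.
  + by apply: trig_poly_ext (trig_add h h') => x; ring.
  + by apply: trig_poly_ext (trig_scale a h) => x; ring.
- by apply: trig_poly_ext (trig_add h h') => x; ring.
- by apply: trig_poly_ext (trig_scale a h) => x; ring.
Qed.

Lemma trig_prod (I : Type) (r : seq I) (F : I -> 'cV[R]_M -> R) :
  (forall i, trig_poly (F i)) -> trig_poly (fun x => \prod_(i <- r) F i x).
Proof.
move=> tF; elim: r => [|i r ih].
  by apply: trig_poly_ext (trig_cst 1) => x; rewrite big_nil.
by apply: trig_poly_ext (trig_mul (tF i) ih) => x; rewrite big_cons.
Qed.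

Lemma trig_bern n k f : trig_poly f -> trig_poly (fun x => bern n k (f x)).
Proof.
move=> tf.
have tf1 : trig_poly (fun x => 1 - f x).
  apply: trig_poly_ext (trig_add (trig_cst 1) (trig_scale (-1) tf)) => x.
  by rewrite mulN1r.
elim: n k => [[|k]|n ih [|k]] /=; try exact: trig_cst.
  exact: trig_mul.
by apply: trig_add; exact: trig_mul.
Qed.

Lemma trig_bounded f : trig_poly f -> exists2 C, 0 <= C & forall x, `|f x| <= C.
Proof.
elim=> {f} [t|t|f g _ [C C0 fC] _ [D D0 gD]|a f _ [C C0 fC]].
- by exists 1 => // x; rewrite ler_norml cos_geN1 cos_le1.
- by exists 1 => // x; rewrite ler_norml sin_geN1 sin_le1.
- exists (C + D); first exact: addr_ge0.
  by move=> x; apply: le_trans (ler_normD _ _) _; exact: lerD.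
- exists (`|a| * C); first exact: mulr_ge0.
  by move=> x; rewrite normrM ler_wpM2l.
Qed.

End trig_polynomials.

Section uniform_continuity.
Variables (R : realType) (M : nat).

Lemma cV_ball_compact (K : R) : compact [set x : 'cV[R]_M | `|x| <= K].
Proof.
have [K0|K0] := ltP K 0.
  rewrite (_ : mkset _ = set0); first exact: compact0.
  by rewrite predeqE => x; split => //=; rewrite leNgt (lt_le_trans K0).
have -> : [set x : 'cV[R]_M | `|x| <= K] =
    trmx @` [set v : 'rV[R]_M | forall i, `[- K, K]%classic (v ord0 i)].
  rewrite predeqE => x; split => /=.
    move=> xK; exists x^T; last by rewrite trmxK.
    move=> i /=; rewrite mxE in_itv/= -ler_norml.
    exact: le_trans (mxentry_le_norm _ _ _) xK.
  move=> [v vK <-]; apply: mxnorm_leP => // i j; rewrite ord1 mxE ler_norml.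
  by have := vK i; rewrite /= in_itv.
apply: continuous_compact; last first.
  apply: (@rV_compact _ _ (fun=> `[- K, K]%classic)) => i.
  exact: segment_compact.
apply: continuous_subspaceT => v; apply: continuous_mx => i j.
rewrite (_ : (fun y => _) = (fun y : 'rV[R]_M => y j i)).
  exact: coord_continuous.
by apply/funext => y; rewrite mxE.
Qed.

(** Only [x] is confined to the ball, as [slutsky_linear] compares with a vector that may leave it.
    Compactness is thus used in its near-covering form. *)
Lemma uniformly_continuous_ball (f : 'cV[R]_M -> R) (K e : R) : continuous f -> 0 < e ->
  exists2 d, 0 < d & forall x y, `|x| <= K -> `|y - x| < d -> `|f y - f x| < e.
Proof.
move=> fc e0.
pose P (d : R) (x : 'cV[R]_M) := forall y, `|y - x| < d -> `|f y - f x| < e.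
have [] := @compact_near_coveringP _ [set x : 'cV[R]_M | `|x| <= K].
move=> /(_ (@cV_ball_compact K))/(_ R (0^'+)%R P _) H _.
have : \forall d \near (0:R)^'+, [set x : 'cV[R]_M | `|x| <= K] `<=` P d.
  apply: H => x _.
  have e2 : 0 < e / 2 by rewrite divr_gt0.
  have /cvgrPdist_lt/(_ _ e2)/nbhs_ballP[r /= r0 Hr] := fc x.
  have r2 : 0 < r / 2 by rewrite divr_gt0.
  exists (ball x (r / 2), [set d | d < r / 2]).
    split; first exact: nbhsx_ballx.
    by apply: nbhs_right_lt.
  move=> [x' d] [/= + dr] y yd; rewrite -ball_normE/= => xx'.
  rewrite -[f y - f x'](subrKA (f x)).
  have h1 : `|f x - f y| < e / 2.
    apply: Hr; rewrite -ball_normE/= -[x - y](subrKA x').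
    rewrite (le_lt_trans (ler_normD _ _))// [X in _ + X]distrC.
    by move: xx' yd; move: `|x - x'| `|y - x'| => u v; lra.
  have h2 : `|f x - f x'| < e / 2.
    by apply: Hr; rewrite -ball_normE/=; move: xx'; move: `|x - x'| => u; lra.
  rewrite (le_lt_trans (ler_normD _ _))// [X in X + _]distrC.
  by move: h1 h2; move: `|f x - f y| `|f x - f x'| => u v; lra.
move=> near; have [d [d0 dP]] : exists d : R, 0 < d /\ [set x : 'cV[R]_M | `|x| <= K] `<=` P d.
  have : \forall d \near (0:R)^'+, 0 < d /\ [set x : 'cV[R]_M | `|x| <= K] `<=` P d.
    by apply: filterS2 near (nbhs_right_gt 0) => d ? ?.
  by move=> /filter_ex.
by exists d => // x y xK; exact: dP.
Qed.

End uniform_continuity.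

(** * Taylor bounds for sine, cosine and the exponential *)

Section elementary_bounds.
Variable R : realType.
Implicit Types x y v : R.

(** Applied repeatedly, each bound serving as the derivative bound of the next, it gives Taylor
    estimates with constant 1 in place of inverse factorials. *)
Lemma mvt_abs_bound (f df : R -> R) (x B : R) :
  (forall y : R, is_derive y 1 f (df y)) -> f 0 = 0 ->
  (forall y, `|y| <= `|x| -> `|df y| <= B) -> `|f x| <= B * `|x|.
Proof.
move=> fd f0 dfB.
have fc : continuous f.
  move=> y; apply: differentiable_continuous; apply/derivable1_diffP.
  by case: (fd y).
have [x0|x0|->] := ltgtP x 0.
- have [y] := @MVT R f df x 0 x0 (fun y _ => fd y) (continuous_subspaceT fc).
  rewrite in_itv/= => /andP[xy y0]; rewrite f0 !sub0r => /eqP; rewrite eqr_oppLR => /eqP ->.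
  by rewrite mulrN opprK normrM ler_wpM2r// dfB// !ltr0_norm//; lra.
- have [y] := @MVT R f df 0 x x0 (fun y _ => fd y) (continuous_subspaceT fc).
  rewrite in_itv/= => /andP[y0 xy]; rewrite f0 !subr0 => ->.
  by rewrite normrM ler_wpM2r// dfB// !gtr0_norm// ltW.
- by rewrite f0 !normr0 mulr0.
Qed.

Lemma abs_sin_le x : `|sin x| <= `|x|.
Proof.
rewrite -[leRHS]mul1r; apply: (@mvt_abs_bound sin cos); [exact: sin0|].
by move=> y _; rewrite ler_norml cos_geN1 cos_le1.
Qed.

Lemma abs_cos_sub1_le x : `|cos x - 1| <= `|x| * `|x|.
Proof.
apply: (@mvt_abs_bound (fun x => cos x - 1) (fun y => - sin y)).
- move=> y; have := is_deriveB (is_derive_cos y) (is_derive_cst (1 : R) y 1).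
  by rewrite subr0.
- by rewrite cos0 subrr.
- by move=> y yx; rewrite normrN; apply: le_trans (abs_sin_le y) yx.
Qed.

Lemma abs_sin_sub_le x : `|sin x - x| <= `|x| ^+ 3.
Proof.
have -> : `|x| ^+ 3 = `|x| * `|x| * `|x| by ring.
apply: (@mvt_abs_bound (fun x => sin x - x) (fun y => cos y - 1)).
- by rewrite sin0 subrr.
- by move=> y yx; apply: le_trans (abs_cos_sub1_le y) _; rewrite ler_pM.
Qed.

Lemma abs_cos_taylor_le x : `|cos x - 1 + x ^+ 2 / 2| <= `|x| ^+ 4.
Proof.
have -> : `|x| ^+ 4 = `|x| ^+ 3 * `|x| by ring.
apply: (@mvt_abs_bound (fun x => cos x - 1 + x ^+ 2 / 2) (fun y => - (sin y - y))).
- move=> y.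
  have h1 := is_deriveB (is_derive_cos y) (is_derive_cst (1 : R) y 1).
  have h2 := is_deriveZ (2^-1) (is_deriveM (is_derive_id y (1 : R)) (is_derive_id y (1 : R))).
  have := is_deriveD h1 h2.
  rewrite (_ : (_ + _ : R -> R) = (fun x => cos x - 1 + x ^+ 2 / 2)); last first.
    by apply/funext => z; rewrite [z ^+ 2 / 2]mulrC expr2.
  move=> h; apply: is_derive_eq; rewrite /GRing.scale/=.
  by field.
- by rewrite cos0 subrr add0r expr0n/= mul0r.
- move=> y yx; rewrite normrN; apply: le_trans (abs_sin_sub_le y) _.
  by rewrite lerXn2r// nnegrE.
Qed.

(** Both sides come from [1 + x <= expR x]: at [-v] it gives nonnegativity, at [v] it gives
    [expR (-v) <= 1 / (1 + v)], and [1 / (1 + v) - 1 + v = v^2 / (1 + v)]. *)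
Lemma abs_expRN_taylor_le v : 0 <= v -> `|expR (- v) - 1 + v| <= v ^+ 2.
Proof.
move=> v0; have h1 := expR_ge1Dx (- v); have h2 := expR_ge1Dx v.
rewrite ger0_norm; last by lra.
rewrite expRN.
have : (expR v)^-1 <= (1 + v)^-1 by rewrite lef_pV2// posrE ?expR_gt0//; lra.
have e : (1 + v)^-1 * (1 + v) = 1 by rewrite mulVf// gt_eqF//; lra.
have : 0 <= (1 + v)^-1 by rewrite invr_ge0; lra.
move: ((1 + v)^-1) ((expR v)^-1) e => a b e a0 ba.
have E : a - 1 + v = v ^+ 2 * a by have : a = 1 - v * a; [lra|nra].
apply: (@le_trans _ _ (a - 1 + v)); first by lra.
by rewrite E ler_piMr ?sqr_ge0//; nra.
Qed.

(* A continuous left inverse of [sin] on [[-1/2, 1/2]]; the argument of [asin]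
   is [u] truncated to that interval. *)
Definition asin_trunc (u : R) : R := asin ((`|u + 2^-1| - `|u - 2^-1|) / 2).

Lemma asin_trunc_continuous : continuous asin_trunc.
Proof.
move=> u; apply: (@continuous_comp _ _ _ (fun u : R => (`|u + 2^-1| - `|u - 2^-1|) / 2)).
  apply: continuous_forM; last exact: continuous_for_cst.
  apply: continuous_forB; apply: (continuous_comp _ (@norm_continuous _ R _)).
    by apply: cvgD; [exact: cvg_id|exact: cvg_cst].
  by apply: continuous_forB; [exact: cvg_id|exact: continuous_for_cst].
apply: continuous_asin.
have := ler_normD (u - 2^-1) 1; have := ler_normD (u + 2^-1) (-1).
rewrite normrN normr1 (_ : u + 2^-1 + -1 = u - 2^-1); last by field.
rewrite (_ : u - 2^-1 + 1 = u + 2^-1); last by field.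
move: `|u + 2^-1| `|u - 2^-1| => a b h1 h2; apply/andP; split; lra.
Qed.

Lemma asin_truncK y : `|y| <= 2^-1 -> asin_trunc (sin y) = y.
Proof.
move=> y2; have sy := le_trans (abs_sin_le y) y2.
rewrite /asin_trunc.
move: (sy); rewrite ler_norml => /andP[s1 s2].
rewrite ger0_norm; last by lra.
rewrite ler0_norm; last by lra.
have -> : (sin y + 2^-1 - - (sin y - 2^-1)) / 2 = sin y by field.
apply: sinK; rewrite in_itv/=; have := pi_ge2 R.
by move: y2; rewrite ler_norml => /andP[]; move: (pi : R) => q *; apply/andP; split; lra.
Qed.

End elementary_bounds.

(** * Multivariate Bernstein approximation and its trigonometric form *)

Section bernstein_approximation.
Variables (R : realType) (M : nat).
Implicit Types (h : 'cV[R]_M -> R) (s : 'cV[R]_M).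

Definition grid n (k : {ffun 'I_M -> 'I_n.+1}) : 'cV[R]_M :=
  \col_i ((k i)%:R / n%:R).

(** For [s] in the unit cube, the joint law of [M] independent binomial counts. *)
Definition bern_weight n (k : {ffun 'I_M -> 'I_n.+1}) s : R :=
  \prod_i bern n (k i) (s i 0).

Lemma bern_weight_ge0 n k s : (forall i, 0 <= s i 0 <= 1) -> 0 <= @bern_weight n k s.
Proof. by move=> s01; apply: prodr_ge0 => i _; exact: bern_ge0. Qed.

Lemma sum_bern_weight n s : \sum_k @bern_weight n k s = 1.
Proof.
rewrite /bern_weight -(bigA_distr_bigA (fun i (k : 'I_n.+1) => bern n k (s i 0))).
by rewrite big1// => i _; exact: sum_bern.
Qed.

Lemma bern_weight_marginal n s i (F : nat -> R) :
  \sum_k @bern_weight n k s * F (k i) = \sum_(j < n.+1) F j * bern n j (s i 0).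
Proof.
transitivity (\sum_(k : {ffun 'I_M -> 'I_n.+1})
    \prod_j (bern n (k j) (s j 0) * (if j == i then F (k j) else 1))).
  apply: eq_bigr => k _; rewrite big_split/=; congr (_ * _).
  rewrite (bigD1 i)//= eqxx big1 ?mulr1// => j /negbTE ->//.
rewrite -(bigA_distr_bigA (fun j (k : 'I_n.+1) => bern n k (s j 0) * (if j == i then F k else 1))).
rewrite (bigD1 i)//= [X in _ * X]big1 ?mulr1.
  by apply: eq_bigr => k _; rewrite eqxx mulrC.
move=> j /negbTE ->; under eq_bigr do rewrite mulr1.
exact: sum_bern.
Qed.

(** Bernstein's probabilistic argument: grid points within [d] of [s] cost [e/2] by uniform
    continuity. At the others some coordinate deviates by at least [d], so the trivial bound [2 C]
    is dominated by [2 C / d^2] times the squared deviations, whose means are at most [1/n] each. *)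
Lemma bernstein_approx h (C e : R) : continuous h -> (forall s, `|h s| <= C) -> 0 < e ->
  exists n : nat, forall s, (forall i, 0 <= s i 0 <= 1) ->
    `|h s - \sum_k h (grid k) * @bern_weight n k s| <= e.
Proof.
move=> hc hC e0.
have e2 : 0 < e / 2 by rewrite divr_gt0.
have [d d0 hd] := uniformly_continuous_ball 1 hc e2.
have C0 : 0 <= C by exact: le_trans (hC 0).
pose K := 2 * C / d ^+ 2 * M%:R.
have d20 : 0 < d ^+ 2 by rewrite exprn_gt0.
have K0 : 0 <= K by rewrite mulr_ge0// divr_ge0 ?mulr_ge0// ltW.
pose n := (Num.trunc (K / (e / 2))).+1.
have nK : K / n%:R <= e / 2.
  rewrite ler_pdivrMr ?ltr0n// mulrC -ler_pdivrMr//.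
  by apply/ltW/truncnS_gt.
have n0 : n%:R != 0 :> R by rewrite pnatr_eq0.
clearbody n; exists n => s s01.
have s1 : `|s| <= 1.
  apply: mxnorm_leP => // i j; rewrite ord1; have /andP[a b] := s01 i.
  by rewrite ger0_norm.
have -> : h s - \sum_k h (@grid n k) * @bern_weight n k s =
    \sum_k (h s - h (@grid n k)) * @bern_weight n k s.
  apply/esym; under eq_bigr do rewrite mulrBl.
  by rewrite sumrB -mulr_sumr sum_bern_weight mulr1.
apply: le_trans (ler_norm_sum _ _ _) _.
have key (k : {ffun 'I_M -> 'I_n.+1}) : `|h s - h (grid k)| <=
    e / 2 + \sum_i 2 * C / d ^+ 2 * ((k i)%:R / n%:R - s i 0) ^+ 2.
  have t0 i : 0 <= 2 * C / d ^+ 2 * ((k i)%:R / n%:R - s i 0) ^+ 2.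
    by rewrite mulr_ge0 ?sqr_ge0// divr_ge0 ?mulr_ge0// ltW.
  have [sd|sd] := ltP `|grid k - s| d.
    rewrite distrC; apply: le_trans (ltW (hd _ _ s1 sd)) _.
    by rewrite lerDl sumr_ge0.
  have [i id] : exists i, d <= `|(k i)%:R / n%:R - s i 0|.
    apply: contrapT => /forallNP H.
    have dn : `|grid k - s| < d.
      rewrite [`|_|]mx_normrE; apply/bigmax_ltP; split => // -[i j] _ /=.
      by rewrite ord1 entryB mxE ltNge; apply/negP/H.
    by move: sd; rewrite leNgt dn.
  apply: (@le_trans _ _ (2 * C)).
    apply: le_trans (ler_normB _ _) _.
    by apply: le_trans (lerD (hC _) (hC _)) _; rewrite mulrDl mul1r.
  rewrite (bigD1 i)//= addrA; apply: (@le_trans _ _ (2 * C / d ^+ 2 * ((k i)%:R / n%:R - s i 0) ^+ 2)).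
    rewrite -mulrA ler_peMr// ?mulr_ge0// mulrC ler_pdivlMr// mul1r.
    by rewrite -[leRHS]real_normK ?num_real// lerXn2r// nnegrE// ltW.
  rewrite -addrA addrCA lerDl addr_ge0 ?sumr_ge0//; last exact: ltW.
apply: (@le_trans _ _ (\sum_(k : {ffun 'I_M -> 'I_n.+1})
    (e / 2 + \sum_i 2 * C / d ^+ 2 * ((k i)%:R / n%:R - s i 0) ^+ 2) * bern_weight k s)).
  apply: ler_sum => k _; rewrite normrM (ger0_norm (bern_weight_ge0 _ s01)).
  by rewrite ler_wpM2r// bern_weight_ge0.
under eq_bigr do rewrite mulrDl.
rewrite big_split/= -mulr_sumr sum_bern_weight mulr1.
under eq_bigr do rewrite mulr_suml.
rewrite exchange_big/=.
have var i : \sum_(k : {ffun 'I_M -> 'I_n.+1}) 2 * C / d ^+ 2 * ((k i)%:R / n%:R - s i 0) ^+ 2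
    * bern_weight k s <= 2 * C / d ^+ 2 / n%:R.
  under eq_bigr do rewrite -mulrA [_ ^+ 2 * _]mulrC.
  rewrite -mulr_sumr; apply: ler_wpM2l.
    by apply: divr_ge0; [exact: mulr_ge0|exact: ltW].
  have /= -> := bern_weight_marginal n s i (fun j => (j%:R / n%:R - s i 0) ^+ 2).
  have -> : \sum_(j < n.+1) (j%:R / n%:R - s i 0) ^+ 2 * bern n j (s i 0) =
      n%:R ^- 2 * \sum_(j < n.+1) (j%:R - n%:R * s i 0) ^+ 2 * bern n j (s i 0).
    by rewrite mulr_sumr; apply: eq_bigr => j _; field.
  rewrite bern_variance subrr expr0n/= addr0.
  have -> : n%:R ^- 2 * (n%:R * s i 0 * (1 - s i 0)) = n%:R^-1 * (s i 0 * (1 - s i 0)).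
    by field.
  by rewrite ler_piMr ?invr_ge0//; have /andP[a b] := s01 i; nra.
apply: (@le_trans _ _ (e / 2 + e / 2)); last by lra.
rewrite lerD2l; apply: le_trans (ler_sum _ (fun i _ => var i)) _.
rewrite sumr_const card_ord -[_ *+ M]mulr_natl.
by have -> : M%:R * (2 * C / d ^+ 2 / n%:R) = K / n%:R by rewrite /K; ring.
Qed.

(** The point [x] is sent to [s i = (1 + sin (x i / 2K)) / 2] in the unit cube and the Bernstein sum
    is evaluated there. It is a convex combination of values of [f], so it is bounded by [C]
    everywhere and not only on the ball. *)
Lemma trig_approx (f : 'cV[R]_M -> R) (C K e : R) : continuous f ->
  (forall x, `|f x| <= C) -> 0 < K -> 0 < e ->
  exists g, [/\ trig_poly g, forall x, `|g x| <= C &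
    forall x, `|x| <= K -> `|f x - g x| <= e].
Proof.
move=> fc fC K0 e0.
(* Continuous on the whole space, and inverse to the substitution when [|x| <= K]: then
   [|x i / 2K| <= 1/2], the range where [asin_trunc] undoes [sin]. *)
pose back (s : 'cV[R]_M) : 'cV[R]_M := \col_i (2 * K * asin_trunc (2 * s i 0 - 1)).
have backc : continuous back.
  move=> s; apply: continuous_mx => i j.
  have -> : (fun y => back y i j) = (fun y => 2 * K * asin_trunc (2 * y i 0 - 1)).
    by apply/funext => y; rewrite mxE.
  apply: continuous_forM; first exact: continuous_for_cst.
  apply: (@continuous_comp _ _ _ (fun y : 'cV[R]_M => 2 * y i 0 - 1)); last exact: asin_trunc_continuous.
  apply: continuous_forB; last exact: continuous_for_cst.
  apply: continuous_forM; first exact: continuous_for_cst.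
  exact: coord_continuous.
have hc : continuous (f \o back) by move=> s; apply: continuous_comp; [exact: backc|exact: fc].
have [n Hn] := bernstein_approx hc (fun s => fC (back s)) e0.
pose sn (x : 'cV[R]_M) : 'cV[R]_M := \col_i ((1 + sin (x i 0 / (2 * K))) / 2).
have sn01 x i : 0 <= sn x i 0 <= 1.
  rewrite mxE; have := sin_geN1 (x i 0 / (2 * K)); have := sin_le1 (x i 0 / (2 * K)).
  by move: (sin _) => a h1 h2; apply/andP; split; lra.
exists (fun x => \sum_k (f \o back) (grid k) * @bern_weight n k (sn x)); split.
- apply: trig_sum => k; apply: trig_scale; apply: trig_prod => i.
  apply: (@trig_bern _ _ n (k i) (fun x => sn x i 0)).
  pose t : 'cV[R]_M := (2 * K)^-1 *: delta_mx i 0.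
  have := trig_scale 2^-1 (trig_add (trig_cst M (1 : R)) (trig_sin t)).
  apply: trig_poly_ext => x; rewrite mxE mulrC; congr ((1 + sin _) / 2).
  rewrite dotE (bigD1 i)//= big1 ?addr0.
    by rewrite !mxE !eqxx mulr1 mulrC.
  by move=> j ji; rewrite !mxE (negbTE ji) mulr0 mul0r.
- move=> x; apply: le_trans (ler_norm_sum _ _ _) _.
  rewrite -[leRHS]mulr1 -(sum_bern_weight n (sn x)) mulr_sumr; apply: ler_sum => k _.
  have w0 := bern_weight_ge0 k (sn01 x).
  by rewrite normrM (ger0_norm w0) ler_wpM2r//; exact: fC.
- move=> x xK; have := Hn (sn x) (sn01 x).
  suff -> : (f \o back) (sn x) = f x by [].
  congr f; apply/matrixP => i j; rewrite ord1 !mxE.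
  have -> : 2 * ((1 + sin (x i 0 / (2 * K))) / 2) - 1 = sin (x i 0 / (2 * K)) by field.
  rewrite asin_truncK; first by field; rewrite gt_eqF.
  have K2 : 0 < 2 * K by rewrite mulr_gt0.
  rewrite normrM normfV (gtr0_norm K2) ler_pdivrMr//.
  by rewrite mulrA mulVf// mul1r; exact: le_trans (mxentry_le_norm _ _ _) xK.
Qed.

End bernstein_approximation.

(** * Convergence in law from characteristic functions *)

Section expectation.
Context d (T : measurableType d) (R : realType) (P : probability T R).
Implicit Types (u v : T -> R) (A : set T).

Lemma bounded_integrable u (C : R) : measurable_fun setT u -> (forall w, `|u w| <= C) ->
  P.-integrable setT (EFin \o u).
Proof.
move=> mu uC; apply: measurable_bounded_integrable => //.
  by rewrite (le_lt_trans (probability_le1 P _))// ltry.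
exists C; split; first by rewrite num_real.
by move=> x Cx w _ /=; exact: le_trans (uC w) (ltW Cx).
Qed.

Lemma integral_bounded_EFin u (C : R) : measurable_fun setT u -> (forall w, `|u w| <= C) ->
  (\int[P]_w (u w)%:E = (\int[P]_w u w)%:E)%E.
Proof.
move=> mu uC; rewrite /Rintegral fineK//.
by apply: integrable_fin_num => //; exact: bounded_integrable uC.
Qed.

(** The integrand is at most [e] off the bad event [A] and at most [2 C] on it. *)
Lemma expectation_close u v A (C e : R) : measurable_fun setT u -> measurable_fun setT v ->
  measurable A -> (forall w, `|u w| <= C) -> (forall w, `|v w| <= C) -> 0 <= e ->
  (forall w, ~ A w -> `|u w - v w| <= e) ->
  `|\int[P]_w u w - \int[P]_w v w| <= e + 2 * C * fine (P A).
Proof.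
move=> mu mv mA uC vC e0 uv.
have iu := bounded_integrable mu uC; have iv := bounded_integrable mv vC.
(* A probability space is nonempty, so [C] bounds some absolute value. *)
have C0 : 0 <= C.
  have [w _] : exists w : T, True.
    apply: contrapT => /forallNP H.
    have : P setT = 0%E by rewrite (_ : setT = set0) ?measure0//; rewrite predeqE => w; case: (H w).
    by rewrite probability_setT => /eqP; rewrite onee_eq0.
  exact: le_trans (uC w).
have muv : measurable_fun setT (fun w => u w - v w) by exact: measurable_funB.
have buv w : `|u w - v w| <= C + C by rewrite (le_trans (ler_normB _ _))// lerD.
have iuv := bounded_integrable muv buv.
have mab : measurable_fun setT (fun w => `|u w - v w|).
  by apply: measurableT_comp => //; exact: measurable_normr.
have iabs : P.-integrable setT (EFin \o (fun w => `|u w - v w|)).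
  by apply: (@bounded_integrable _ (C + C)) => // w; rewrite normr_id.
rewrite -RintegralB//; apply: le_trans (le_normr_Rintegral measurableT iuv) _.
have mI : measurable_fun setT (\1_A : T -> R) by exact: measurable_indic.
have I1 w : `|(\1_A w : R)| <= 1.
  by rewrite indicE; case: (w \in A); rewrite ?normr1 ?normr0.
have iI := bounded_integrable mI I1.
have iZ : P.-integrable setT (EFin \o (fun w => 2 * C * (\1_A w : R))).
  apply: (@bounded_integrable _ (2 * C)); first exact: measurable_funM.
  by move=> w; rewrite normrM ger0_norm ?mulr_ge0// ler_piMr ?mulr_ge0.
have ic : P.-integrable setT (EFin \o (fun _ : T => e)).
  by apply: (@bounded_integrable _ `|e|).
have -> : e + 2 * C * fine (P A) = \int[P]_w (e + 2 * C * (\1_A w : R)).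
  have cE : \int[P]_w e = e.
    transitivity (fine (e%:E * P setT)%E); first by rewrite /Rintegral integral_cst.
    by rewrite probability_setT mule1.
  rewrite RintegralD// RintegralZl// cE.
  congr (_ + _ * _).
  by rewrite /Rintegral integral_indic// setIT.
apply: le_Rintegral => //.
  apply: (@bounded_integrable _ (e + 2 * C)).
    by apply: measurable_funD => //; exact: measurable_funM.
  move=> w; apply: le_trans (ler_normD _ _) _; rewrite (ger0_norm e0) lerD2l.
  by rewrite normrM ger0_norm ?mulr_ge0// ler_piMr ?mulr_ge0.
move=> w _; rewrite indicE; have [wA|wA] := boolP (w \in A).
  rewrite mulr1; apply: le_trans (buv w) _; move: e0; lra.
rewrite mulr0 addr0; apply: uv => Aw; move: wA.
by rewrite (mem_set Aw).
Qed.

End expectation.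

Section measurability.
Context d (T : measurableType d) (R : realType) (M : nat).
Implicit Types (X : T -> 'cV[R]_M).

Lemma measurable_dot X t : rvec X -> measurable_fun setT (fun w => dot t (X w)).
Proof.
move=> mX.
have -> : (fun w => dot t (X w)) = (fun w => \sum_i t i 0 * X w i 0).
  by apply/funext => w; rewrite dotE.
by apply: measurable_sum => i; apply: measurable_funM => //; exact: mX.
Qed.

Lemma measurable_trig_poly X g : rvec X -> trig_poly g -> measurable_fun setT (g \o X).
Proof.
move=> mX; elim=> {g} [t|t|f g _ mf _ mg|a f _ mf].
- apply: (measurableT_comp (f := @cos R)); last exact: measurable_dot.
  by apply: continuous_measurable_fun; exact: continuous_cos.
- apply: (measurableT_comp (f := @sin R)); last exact: measurable_dot.
  by apply: continuous_measurable_fun; exact: continuous_sin.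
- exact: measurable_funD.
- exact: measurable_funM.
Qed.

(** Since [rvec] speaks of coordinates only, [f \o X] is obtained as a pointwise limit of
    trigonometric polynomials in [X], the [m]-th within [1/(m+1)] of [f] on the ball of radius
    [m + 1]. *)
Lemma measurable_continuous_rvec X (f : 'cV[R]_M -> R) (C : R) : rvec X -> continuous f ->
  (forall x, `|f x| <= C) -> measurable_fun setT (f \o X).
Proof.
move=> mX fc fC.
have H (m : nat) : exists g, trig_poly g /\
    forall x : 'cV[R]_M, `|x| <= m.+1%:R -> `|f x - g x| <= m.+1%:R^-1.
  have [//|//|g [tg _ gf]] := @trig_approx R M f C m.+1%:R m.+1%:R^-1 fc fC.
  by exists g.
have [g Hg] := choice H.
apply: (@measurable_fun_cvg _ _ _ _ (fun m => g m \o X)).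
  by move=> m; apply: measurable_trig_poly => //; case: (Hg m).
move=> w _; apply/cvgrPdist_le => e e0.
near=> m => /=.
have [_ gm] := Hg m; apply: le_trans (gm _ _) _.
  apply: (@le_trans _ _ m%:R); last by rewrite ler_nat.
  by near: m; exact: nbhs_infty_ger.
by apply/ltW; near: m; exact: near_infty_natSinv_lt (PosNum e0).
Unshelve. all: by end_near. Qed.

Lemma rvec_norm_measurable X (K : R) : rvec X -> measurable [set w | K < `|X w|].
Proof.
move=> mX; have [K0|K0] := ltP K 0.
  rewrite (_ : mkset _ = setT); first exact: measurableT.
  by rewrite predeqE => w; split => // _; exact: lt_le_trans K0 _.
have -> : [set w | K < `|X w|] = \big[setU/set0]_(i < M) [set w | K < `|X w i 0|].
  rewrite predeqE => w; split => /= [KX|].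
    apply: contrapT => H.
    have : `|X w| <= K.
      apply: mxnorm_leP => // i j; rewrite ord1 leNgt; apply/negP => Ki.
      by apply: H; rewrite -bigcup_seq; exists i => //=; rewrite mem_index_enum.
    by rewrite leNgt KX.
  rewrite -bigcup_seq => -[i _ /= Ki]; apply: lt_le_trans Ki _.
  exact: mxentry_le_norm.
apply: bigsetU_measurable => i _.
have mn : measurable_fun setT (fun w => `|X w i 0|).
  by apply: (measurableT_comp (f := @Num.norm R R)) => //; exact: mX.
have := mn measurableT `]K, +oo[%classic (measurable_itv _).
by rewrite setTI; congr measurable; rewrite predeqE => w /=; rewrite in_itv/= andbT.
Qed.

End measurability.

(** * Tightness, continuity theorem and a Slutsky-type transfer *)

Section levy.
Context (R : realType) d (T : measurableType d) (P : probability T R).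
Context d' (T' : measurableType d') (Q : probability T' R) (M : nat).
Implicit Types (X V : nat -> T -> 'cV[R]_M) (Z : T' -> 'cV[R]_M) (f : 'cV[R]_M -> R).

Definition tight V := forall e : R, 0 < e -> exists2 K : R, 0 < K &
  \forall N \near \oo, fine (P [set w | K < `|V N w|]) <= e.

Lemma rvec_tail_small Z (e : R) : rvec Z -> 0 < e ->
  exists2 K : R, 0 < K & fine (Q [set w | K < `|Z w|]) <= e.
Proof.
move=> mZ e0.
pose F (n : nat) := [set w | n%:R < `|Z w|].
have mF n : measurable (F n) by exact: rvec_norm_measurable.
have F0 : \bigcap_n F n = set0.
  rewrite predeqE => w; split => // H.
  have := H (Num.trunc `|Z w|).+1 I; rewrite /F/= ltNge.
  by rewrite (ltW (truncnS_gt _)).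
have : (Q \o F) n @[n --> \oo] --> Q (\bigcap_n F n).
  apply: nonincreasing_cvg_mu => //.
  - by rewrite (le_lt_trans (probability_le1 Q _))// ltry.
  - by rewrite F0.
  - move=> m n mn; apply/subsetPset => w; rewrite /F/=; apply: le_lt_trans.
    by rewrite ler_nat.
rewrite F0 measure0 => /fine_cvg/cvgrPdist_le/(_ e e0) H.
have [n [n0 nH]] : exists n, (0 < n)%N /\ `|0 - (fine \o (Q \o F)) n| <= e.
  have : \forall n \near \oo, (0 < n)%N /\ `|0 - (fine \o (Q \o F)) n| <= e.
    by apply: filterS2 H (nbhs_infty_gt 0) => n ? ?.
  by move=> /filter_ex.
exists n%:R; first by rewrite ltr0n.
by move: nH; rewrite sub0r normrN; apply: le_trans; exact: ler_norm.
Qed.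

Lemma cvg_trig_poly X Z g : (forall N, rvec (X N)) -> rvec Z ->
  (forall t, (\int[P]_w cos (dot t (X N w))) @[N --> \oo] --> \int[Q]_w cos (dot t (Z w))) ->
  (forall t, (\int[P]_w sin (dot t (X N w))) @[N --> \oo] --> \int[Q]_w sin (dot t (Z w))) ->
  trig_poly g ->
  (\int[P]_w g (X N w)) @[N --> \oo] --> \int[Q]_w g (Z w).
Proof.
move=> mX mZ ccos csin.
have iX N h : trig_poly h -> P.-integrable setT (EFin \o (h \o X N)).
  move=> th; have [C _ hC] := trig_bounded th.
  by apply: (bounded_integrable P (measurable_trig_poly (mX N) th)) => w; exact: hC.
have iZ h : trig_poly h -> Q.-integrable setT (EFin \o (h \o Z)).
  move=> th; have [C _ hC] := trig_bounded th.
  by apply: (bounded_integrable Q (measurable_trig_poly mZ th)) => w; exact: hC.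
elim=> {g} [t|t|f g tf cf tg cg|a f tf cf]; [exact: ccos|exact: csin| |].
- have -> : (fun N => \int[P]_w (f (X N w) + g (X N w))) =
      (fun N => \int[P]_w f (X N w) + \int[P]_w g (X N w)).
    by apply/funext => N; apply: RintegralD => //; exact: iX.
  have -> : \int[Q]_w (f (Z w) + g (Z w)) = \int[Q]_w f (Z w) + \int[Q]_w g (Z w).
    by apply: RintegralD => //; exact: iZ.
  exact: cvgD.
- have -> : (fun N => \int[P]_w (a * f (X N w))) = (fun N => a * \int[P]_w f (X N w)).
    by apply/funext => N; apply: RintegralZl => //; exact: iX.
  have -> : \int[Q]_w (a * f (Z w)) = a * \int[Q]_w f (Z w).
    by apply: RintegralZl => //; exact: iZ.
  by apply: cvgM => //; exact: cvg_cst.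
Qed.

Lemma conv_in_law_Rintegral X Z : (forall N, rvec (X N)) -> rvec Z ->
  (forall f (C : R), continuous f -> (forall x, `|f x| <= C) ->
    (\int[P]_w f (X N w)) @[N --> \oo] --> \int[Q]_w f (Z w)) ->
  conv_in_law P Q X Z.
Proof.
move=> mX mZ H f fc [C fC].
rewrite (integral_bounded_EFin Q (measurable_continuous_rvec mZ fc fC) (fun w => fC (Z w))).
apply: cvg_EFin; last exact: H.
apply: nearW => N.
by rewrite (integral_bounded_EFin P (measurable_continuous_rvec (mX N) fc fC) (fun w => fC (X N w))).
Qed.

Lemma levy_continuity X Z f (C : R) : (forall N, rvec (X N)) -> rvec Z -> tight X ->
  (forall t, (\int[P]_w cos (dot t (X N w))) @[N --> \oo] --> \int[Q]_w cos (dot t (Z w))) ->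
  (forall t, (\int[P]_w sin (dot t (X N w))) @[N --> \oo] --> \int[Q]_w sin (dot t (Z w))) ->
  continuous f -> (forall x, `|f x| <= C) ->
  (\int[P]_w f (X N w)) @[N --> \oo] --> \int[Q]_w f (Z w).
Proof.
move=> mX mZ tX ccos csin fc fC.
have C0 : 0 <= C by exact: le_trans (fC 0).
apply/cvgrPdist_le => e e0.
have e8 : 0 < e / 8 by rewrite divr_gt0.
(* Tail mass with [2 C b <= e/8]; the 1 covers [C = 0]. Passing from [f] to [g] costs [e/4] under
   each law, and the two integrals of [g] differ by [e/8]. *)
pose b := e / 8 / (2 * C + 1).
have D0 : 0 < 2 * C + 1 by rewrite ltr_wpDl// mulr_ge0.
have b0 : 0 < b by rewrite divr_gt0.
have bC : 2 * C * b <= e / 8.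
  by rewrite /b mulrA ler_pdivrMr// [leLHS]mulrC ler_wpM2l ?(ltW e8)// lerDl.
have [K1 K10 H1] := tX b b0.
have [K2 K20 H2] := rvec_tail_small mZ b0.
pose K := Num.max K1 K2.
have [//|//|g [tg gC fg]] := @trig_approx R M f C K (e / 8) fc fC.
  by rewrite lt_max K10.
have /cvgrPdist_le/(_ _ e8) cg := cvg_trig_poly mX mZ ccos csin tg.
have fZ : `|\int[Q]_w f (Z w) - \int[Q]_w g (Z w)| <= e / 4.
  have mA : measurable [set w | K2 < `|Z w|] by exact: rvec_norm_measurable.
  apply: le_trans (expectation_close Q (measurable_continuous_rvec mZ fc fC) (measurable_trig_poly mZ tg) mA (fun w => fC (Z w)) (fun w => gC (Z w)) (ltW e8) _) _.
    move=> w /negP; rewrite -leNgt => wK; apply: fg.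
    by rewrite (le_trans wK)// le_max lexx orbT.
  have : 2 * C * fine (Q [set w | K2 < `|Z w|]) <= 2 * C * b by rewrite ler_wpM2l ?mulr_ge0.
  move: bC; lra.
near=> N.
have fX : `|\int[P]_w f (X N w) - \int[P]_w g (X N w)| <= e / 4.
  have mA : measurable [set w | K1 < `|X N w|] by exact: rvec_norm_measurable.
  apply: le_trans (expectation_close P (measurable_continuous_rvec (mX N) fc fC) (measurable_trig_poly (mX N) tg) mA (fun w => fC (X N w)) (fun w => gC (X N w)) (ltW e8) _) _.
    move=> w /negP; rewrite -leNgt => wK; apply: fg.
    by rewrite (le_trans wK)// le_max lexx.
  have : 2 * C * fine (P [set w | K1 < `|X N w|]) <= 2 * C * b.
    by rewrite ler_wpM2l ?mulr_ge0//; near: N.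
  move: bC; lra.
have gg : `|\int[Q]_w g (Z w) - \int[P]_w g (X N w)| <= e / 8 by near: N.
move: fZ fX gg.
move: (\int[Q]_w f (Z w)) (\int[Q]_w g (Z w)) (\int[P]_w f (X N w)) (\int[P]_w g (X N w)) => p q r s.
rewrite !ler_norml => /andP[? ?] /andP[? ?] /andP[? ?]; apply/andP; split; lra.
Unshelve. all: by end_near. Qed.

Lemma rvec_mulmx (A : 'M[R]_M) (V : T -> 'cV[R]_M) : rvec V -> rvec (fun w => A *m V w).
Proof.
move=> mV i; under eq_fun do rewrite mxE.
by apply: measurable_sum => j; apply: measurable_funM => //; exact: mV.
Qed.

Lemma tight_mulmx (A : 'M[R]_M) V : (forall N, rvec (V N)) -> tight V ->
  tight (fun N w => A *m V N w).
Proof.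
move=> mV tV e e0; have [K K0 H] := tV e e0.
pose B : R := M%:R * `|A| + 1.
have B1 : 0 < B by rewrite ltr_wpDl// mulr_ge0.
exists (B * K); first by rewrite mulr_gt0.
apply: filterS H => N; apply: le_trans.
have mA (W : T -> 'cV[R]_M) L : rvec W -> measurable [set w | L < `|W w|].
  by move=> mW; exact: rvec_norm_measurable.
apply: fine_le; rewrite ?fin_num_measure//; try exact: mA; try (apply: mA; exact: rvec_mulmx).
apply: le_measure; rewrite ?inE; try exact: mA; try (apply: mA; exact: rvec_mulmx).
move=> w /= BK; rewrite ltNge; apply/negP => VK; move: BK; rewrite ltNge => /negP; apply.
apply: le_trans (norm_mulmx _ _) _; by apply: ler_pM => //; rewrite lerDl.
Qed.

(** The closeness of [X N] to [A V N] is required only where [V N] is bounded, which is where the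
    estimator is controlled; tightness of [V] makes the complement negligible. *)
Lemma slutsky_linear (A : 'M[R]_M) X V Z :
  (forall N, rvec (X N)) -> (forall N, rvec (V N)) -> rvec Z -> tight V ->
  (forall t, (\int[P]_w cos (dot t (A *m V N w))) @[N --> \oo] --> \int[Q]_w cos (dot t (Z w))) ->
  (forall t, (\int[P]_w sin (dot t (A *m V N w))) @[N --> \oo] --> \int[Q]_w sin (dot t (Z w))) ->
  (forall K e : R, 0 < K -> 0 < e -> \forall N \near \oo, forall w,
    `|V N w| <= K -> `|X N w - A *m V N w| < e) ->
  conv_in_law P Q X Z.
Proof.
move=> mX mV mZ tV ccos csin close.
apply: conv_in_law_Rintegral => // f C fc fC.
have mAV N : rvec (fun w => A *m V N w) by exact: rvec_mulmx.
have /cvgrPdist_le cAV := levy_continuity mAV mZ (tight_mulmx A mV tV) ccos csin fc fC.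
have C0 : 0 <= C by exact: le_trans (fC 0).
apply/cvgrPdist_le => e e0.
have e4 : 0 < e / 4 by rewrite divr_gt0.
pose b := e / 4 / (2 * C + 1).
have D0 : 0 < 2 * C + 1 by rewrite ltr_wpDl// mulr_ge0.
have b0 : 0 < b by rewrite divr_gt0.
have bC : 2 * C * b <= e / 4.
  by rewrite /b mulrA ler_pdivrMr// [leLHS]mulrC ler_wpM2l ?(ltW e4)// lerDl.
have [K K0 HK] := tV b b0.
have [r r0 Hr] := uniformly_continuous_ball (M%:R * `|A| * K) fc e4.
have Hc := close K r K0 r0; have Hg := cAV _ e4.
near=> N.
have fX : `|\int[P]_w f (X N w) - \int[P]_w f (A *m V N w)| <= e / 2.
  have mA : measurable [set w | K < `|V N w|] by exact: rvec_norm_measurable.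
  apply: le_trans (expectation_close P (measurable_continuous_rvec (mX N) fc fC) (measurable_continuous_rvec (mAV N) fc fC) mA (fun w => fC (X N w)) (fun w => fC (A *m V N w)) (ltW e4) _) _.
    move=> w /negP; rewrite -leNgt => wK; apply/ltW/Hr.
      by apply: le_trans (norm_mulmx _ _) _; rewrite ler_wpM2l ?mulr_ge0.
    by move: w wK; near: N.
  have : 2 * C * fine (P [set w | K < `|V N w|]) <= 2 * C * b.
    by rewrite ler_wpM2l ?mulr_ge0//; near: N.
  move: bC; lra.
have gg : `|\int[Q]_w f (Z w) - \int[P]_w f (A *m V N w)| <= e / 4 by near: N.
move: fX gg.
move: (\int[Q]_w f (Z w)) (\int[P]_w f (X N w)) (\int[P]_w f (A *m V N w)) => p q s.
rewrite !ler_norml => /andP[? ?] /andP[? ?]; apply/andP; split; lra.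
Unshelve. all: by end_near. Qed.

End levy.

(** * Characteristic functions of independent sums *)

Section product_law.
Import ComplexField.Normc.
Variables (R : realType) (K S : finType) (pi : K -> S -> R).
Hypothesis pi_ge0 : forall k s, 0 <= pi k s.
Hypothesis sum_pi : forall k, \sum_s pi k s = 1.
Local Notation Re := (@complex.Re R).
Local Notation Im := (@complex.Im R).
Implicit Type xi : K -> S -> R.

Definition prod_weight (c : {ffun K -> S}) : R := \prod_k pi k (c k).

Lemma prod_weight_marginal k (F : S -> R) :
  \sum_(c : {ffun K -> S}) F (c k) * prod_weight c = \sum_s F s * pi k s.
Proof.
transitivity (\sum_(c : {ffun K -> S}) \prod_j ((if j == k then F (c j) else 1) * pi j (c j))).
  apply: eq_bigr => c _; rewrite big_split/=; congr (_ * _).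
  by rewrite (bigD1 k)//= eqxx big1 ?mulr1// => j /negbTE ->.
rewrite -(bigA_distr_bigA (fun j s => (if j == k then F s else 1) * pi j s)).
rewrite (bigD1 k)//= eqxx [X in _ * X]big1 ?mulr1// => j /negbTE ->.
by under eq_bigr do rewrite mul1r.
Qed.

(** The cross terms of the variance: the product factorizes over the coordinates and the [k]-th
    factor is zero. *)
Lemma prod_weight_pair k l (F G : S -> R) : k != l -> \sum_s F s * pi k s = 0 ->
  \sum_(c : {ffun K -> S}) F (c k) * G (c l) * prod_weight c = 0.
Proof.
move=> kl F0.
transitivity (\sum_(c : {ffun K -> S}) \prod_j ((if j == k then F (c j) else if j == l then G (c j) else 1)
    * pi j (c j))).
  apply: eq_bigr => c _; rewrite big_split/=; congr (_ * _).
  rewrite (bigD1 k)//= eqxx; congr (_ * _).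
  have lk : l != k by rewrite eq_sym.
  rewrite (bigD1 l lk)/= (negbTE lk) eqxx big1 ?mulr1//.
  by move=> j /andP[/negbTE -> /negbTE ->].
rewrite -(bigA_distr_bigA (fun j s => (if j == k then F s else if j == l then G s else 1) * pi j s)).
by rewrite (bigD1 k)//= eqxx F0 mul0r.
Qed.

Lemma prod_weight_variance xi : (forall k, \sum_s xi k s * pi k s = 0) ->
  \sum_(c : {ffun K -> S}) (\sum_k xi k (c k)) ^+ 2 * prod_weight c = \sum_k \sum_s xi k s ^+ 2 * pi k s.
Proof.
move=> xi0.
transitivity (\sum_k \sum_l \sum_(c : {ffun K -> S}) xi k (c k) * xi l (c l) * prod_weight c).
  transitivity (\sum_(c : {ffun K -> S}) \sum_k \sum_l xi k (c k) * xi l (c l) * prod_weight c).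
    apply: eq_bigr => c _; rewrite expr2 big_distrlr/= mulr_suml.
    by apply: eq_bigr => k _; rewrite mulr_suml.
  by rewrite exchange_big/=; apply: eq_bigr => k _; rewrite exchange_big.
apply: eq_bigr => k _; rewrite (bigD1 k)//= [X in _ + X]big1 ?addr0.
  rewrite -(prod_weight_marginal k (fun s => xi k s ^+ 2)).
  by apply: eq_bigr => c _; rewrite expr2.
by move=> l lk; apply: prod_weight_pair; rewrite 1?eq_sym.
Qed.

(** The complex exponential of [ix]. Complex numbers serve only to make the characteristic function
    of a sum a product. *)
Definition cis (x : R) : R[i] := (cos x +i* sin x)%C.

Lemma cisD x y : cis (x + y) = cis x * cis y.
Proof. by rewrite /cis cosD sinD; simpc; congr (_ +i* _)%C; ring. Qed.

Lemma cis0 : cis 0 = 1.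
Proof. by rewrite /cis cos0 sin0. Qed.

Lemma cis_sum (I : Type) (r : seq I) (F : I -> R) :
  cis (\sum_(i <- r) F i) = \prod_(i <- r) cis (F i).
Proof. by rewrite (big_morph cis cisD cis0). Qed.

Lemma Re_sumc (I : Type) (r : seq I) (F : I -> R[i]) :
  Re (\sum_(i <- r) F i) = \sum_(i <- r) Re (F i).
Proof. by apply: (big_morph Re) => // -[a b] [a' b']. Qed.

Lemma Im_sumc (I : Type) (r : seq I) (F : I -> R[i]) :
  Im (\sum_(i <- r) F i) = \sum_(i <- r) Im (F i).
Proof. by apply: (big_morph Im) => // -[a b] [a' b']. Qed.

Lemma prod_realc (I : Type) (r : seq I) (F : I -> R) :
  (\prod_(i <- r) F i)%:C%C = \prod_(i <- r) (F i)%:C%C.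
Proof. by rewrite rmorph_prod. Qed.

Lemma normc_sum_le (I : Type) (r : seq I) (F : I -> R[i]) :
  normc (\sum_(i <- r) F i) <= \sum_(i <- r) normc (F i).
Proof.
elim: r => [|i r ih]; first by rewrite !big_nil normc0.
rewrite !big_cons; apply: le_trans (le_normcD _ _) _.
by rewrite lerD2l.
Qed.

Lemma normc_real (x : R) : normc (x%:C)%C = `|x|.
Proof. by rewrite /= expr0n/= addr0 sqrtr_sqr. Qed.

Lemma normc_cis x : normc (cis x) = 1.
Proof. by rewrite /= cos2Dsin2 sqrtr1. Qed.

Lemma normc_ge0 (x : R[i]) : 0 <= normc x.
Proof. by case: x => a b; exact: sqrtr_ge0. Qed.

Lemma abs_Re_le (x : R[i]) : `|Re x| <= normc x.
Proof.
case: x => a b /=; rewrite -sqrtr_sqr ler_sqrt ?lerDl ?sqr_ge0//.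
by rewrite addr_ge0 ?sqr_ge0.
Qed.

Lemma abs_Im_le (x : R[i]) : `|Im x| <= normc x.
Proof.
case: x => a b /=; rewrite -sqrtr_sqr ler_sqrt ?lerDr ?sqr_ge0//.
by rewrite addr_ge0 ?sqr_ge0.
Qed.

Lemma normc_le_ReIm (x : R[i]) : normc x <= `|Re x| + `|Im x|.
Proof.
case: x => a b /=; rewrite -[leRHS]ger0_norm ?addr_ge0// -sqrtr_sqr ler_sqrt ?sqr_ge0//.
rewrite sqrrD !real_normK ?num_real// addrAC lerDl.
by rewrite mulrn_wge0// mulr_ge0.
Qed.

Lemma normc_prod_le1 (I : Type) (r : seq I) (a : I -> R[i]) :
  (forall i, normc (a i) <= 1) ->
  normc (\prod_(i <- r) a i) <= 1.
Proof.
move=> a1; elim: r => [|i r ih]; first by rewrite big_nil normc1.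
by rewrite big_cons normcM mulr_ile1// normc_ge0.
Qed.

(** Telescoping: factors are exchanged one at a time while all others have modulus at most 1. Errors
    of the individual characteristic functions thus add up. *)
Lemma normc_prod_sub (I : Type) (r : seq I) (a b : I -> R[i]) :
  (forall i, normc (a i) <= 1) -> (forall i, normc (b i) <= 1) ->
  normc (\prod_(i <- r) a i - \prod_(i <- r) b i) <=
  \sum_(i <- r) normc (a i - b i).
Proof.
move=> a1 b1; elim: r => [|i r ih]; first by rewrite !big_nil subrr normc0.
rewrite !big_cons.
have -> : a i * \prod_(j <- r) a j - b i * \prod_(j <- r) b j =
  (a i - b i) * \prod_(j <- r) a j + b i * (\prod_(j <- r) a j - \prod_(j <- r) b j) by ring.
apply: le_trans (le_normcD _ _) _; rewrite !normcM lerD//.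
  by rewrite ler_piMr ?normc_ge0//; exact: normc_prod_le1.
apply: le_trans ih; rewrite ler_piMl ?normc_ge0//.
Qed.

Lemma prod_weight_cis xi :
  \sum_(c : {ffun K -> S}) (prod_weight c)%:C%C * cis (\sum_k xi k (c k)) =
  \prod_k \sum_s (pi k s)%:C%C * cis (xi k s).
Proof.
rewrite (bigA_distr_bigA (fun k s => (pi k s)%:C%C * cis (xi k s))).
by apply: eq_bigr => c _; rewrite big_split/= cis_sum prod_realc.
Qed.

(** The real part contributes [eta^4] from the cosine and [eta^4] from the exponential (as
    [sg k <= eta^2]), the imaginary part [eta^3] from the sine after centring; [eta <= 1] merges
    these into [3 eta^3]. *)
Lemma factor_charfun_bound xi (sg : K -> R) (eta : R) k : 0 <= eta <= 1 ->
  (forall k s, `|xi k s| <= eta) -> (forall k, \sum_s xi k s * pi k s = 0) ->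
  (forall k, \sum_s xi k s ^+ 2 * pi k s = sg k) ->
  normc (\sum_s (pi k s)%:C%C * cis (xi k s) - (expR (- (sg k / 2)))%:C%C)
  <= 3 * eta ^+ 3.
Proof.
move=> /andP[eta0 eta1] xieta xi0 xi2.
apply: le_trans (normc_le_ReIm _) _.
have ReB (x y : R[i]) : Re (x - y) = Re x - Re y by case: x y => ? ? [].
have ImB (x y : R[i]) : Im (x - y) = Im x - Im y by case: x y => ? ? [].
rewrite ReB ImB Re_sumc Im_sumc /= subr0.
have avg (F : S -> R) (b : R) : (forall s, `|F s| <= b) -> `|\sum_s F s * pi k s| <= b.
  move=> Fb; apply: le_trans (ler_norm_sum _ _ _) _.
  rewrite -[leRHS]mulr1 -(sum_pi k) mulr_sumr; apply: ler_sum => s _.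
  by rewrite normrM [`|pi k s|]ger0_norm// ler_wpM2r.
have s0 : 0 <= sg k.
  by rewrite -xi2; apply: sumr_ge0 => s _; rewrite mulr_ge0// sqr_ge0.
have s1 : sg k <= eta ^+ 2.
  rewrite -[leLHS]ger0_norm// -xi2; apply: avg => s.
  by rewrite normrX lerXn2r// nnegrE.
have e43 : eta ^+ 4 <= eta ^+ 3 by rewrite exprS ler_piMl ?exprn_ge0.
have hR : `|\sum_s Re ((pi k s)%:C%C * cis (xi k s)) - expR (- (sg k / 2))| <= 2 * eta ^+ 3.
  have -> : \sum_s Re ((pi k s)%:C%C * cis (xi k s)) =
      \sum_s (cos (xi k s) - 1 + xi k s ^+ 2 / 2) * pi k s + 1 - sg k / 2.
    rewrite -[X in _ + X - _](sum_pi k) -xi2 mulr_suml -big_split/= -sumrB.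
    by apply: eq_bigr => s _; rewrite /cis/=; field.
  set A := \sum_s _.
  have hA : `|A| <= eta ^+ 4.
    apply: avg => s; apply: le_trans (abs_cos_taylor_le _) _.
    by rewrite lerXn2r// nnegrE.
  have hE : `|expR (- (sg k / 2)) - 1 + sg k / 2| <= eta ^+ 4.
    have h20 : 0 <= sg k / 2 by rewrite divr_ge0.
    apply: le_trans (abs_expRN_taylor_le h20) _.
    have -> : eta ^+ 4 = (eta ^+ 2) ^+ 2 by ring.
    by rewrite lerXn2r ?nnegrE ?sqr_ge0//; lra.
  have -> : A + 1 - sg k / 2 - expR (- (sg k / 2)) =
    A - (expR (- (sg k / 2)) - 1 + sg k / 2) by ring.
  apply: le_trans (ler_normB _ _) _; lra.
have hI : `|\sum_s Im ((pi k s)%:C%C * cis (xi k s))| <= eta ^+ 3.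
  have -> : \sum_s Im ((pi k s)%:C%C * cis (xi k s)) =
      \sum_s (sin (xi k s) - xi k s) * pi k s + \sum_s xi k s * pi k s.
    rewrite -big_split/=; apply: eq_bigr => s _; rewrite /cis/=; ring.
  rewrite xi0 addr0; apply: avg => s; apply: le_trans (abs_sin_sub_le _) _.
  by rewrite lerXn2r// nnegrE.
lra.
Qed.

Lemma charfun_bound xi (sg : K -> R) (eta : R) : 0 <= eta <= 1 ->
  (forall k s, `|xi k s| <= eta) -> (forall k, \sum_s xi k s * pi k s = 0) ->
  (forall k, \sum_s xi k s ^+ 2 * pi k s = sg k) ->
  `|\sum_(c : {ffun K -> S}) cos (\sum_k xi k (c k)) * prod_weight c - expR (- (\sum_k sg k) / 2)|
    <= #|K|%:R * (3 * eta ^+ 3) /\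
  `|\sum_(c : {ffun K -> S}) sin (\sum_k xi k (c k)) * prod_weight c| <= #|K|%:R * (3 * eta ^+ 3).
Proof.
move=> eta01 xieta xi0 xi2.
set z := \sum_(c : {ffun K -> S}) (prod_weight c)%:C%C * cis (\sum_k xi k (c k)).
have ReB (x y : R[i]) : Re (x - y) = Re x - Re y by case: x y => ? ? [].
have ImB (x y : R[i]) : Im (x - y) = Im x - Im y by case: x y => ? ? [].
have zR : Re z = \sum_(c : {ffun K -> S}) cos (\sum_k xi k (c k)) * prod_weight c.
  rewrite /z Re_sumc; apply: eq_bigr => c _; rewrite /cis/=; ring.
have zI : Im z = \sum_(c : {ffun K -> S}) sin (\sum_k xi k (c k)) * prod_weight c.
  rewrite /z Im_sumc; apply: eq_bigr => c _; rewrite /cis/=; ring.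
set y := (expR (- (\sum_k sg k) / 2))%:C%C.
have yE : y = \prod_k (expR (- (sg k / 2)))%:C%C.
  rewrite /y -prod_realc -expR_sum; congr (_%:C)%C; congr expR.
  by rewrite sumrN -mulr_suml mulNr.
have zy : normc (z - y) <= #|K|%:R * (3 * eta ^+ 3).
  rewrite yE /z prod_weight_cis.
  apply: le_trans (normc_prod_sub _ _ _) _.
  - move=> k; apply: le_trans (normc_sum_le _ _) _.
    rewrite -(sum_pi k); apply: ler_sum => s _.
    by rewrite normcM normc_cis mulr1 normc_real ger0_norm.
  - move=> k; rewrite normc_real ger0_norm ?expR_ge0// -expR0 ler_expR oppr_le0.
    rewrite divr_ge0// -xi2; apply: sumr_ge0 => s _.
    by rewrite mulr_ge0// sqr_ge0.
  rewrite mulr_natl -sumr_const; apply: ler_sum => k _.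
  exact: factor_charfun_bound.
split.
  rewrite -zR; apply: le_trans zy; apply: le_trans (abs_Re_le _).
  by rewrite ReB.
rewrite -zI; apply: le_trans zy; apply: le_trans (abs_Im_le _).
by rewrite ImB /= subr0.
Qed.

End product_law.

(** * Expectations of finitely valued independent vectors as finite sums *)

Section finite_law.
Context (R : realType) d (T : measurableType d) (P : probability T R).

Section simple.
Variables (S : finType) (X : T -> S).
Hypothesis mX : forall s, measurable [set w | X w = s].
Let I s : T -> R := \1_[set w | X w = s].

Let mI s : measurable_fun setT (I s).
Proof. exact: measurable_indic. Qed.

Let I_le1 s w : `|I s w| <= 1.
Proof. by rewrite /I indicE; case: (w \in _); rewrite ?normr1 ?normr0. Qed.

Let IE s w : I s w = (X w == s)%:R.
Proof.
rewrite /I indicE; congr ((nat_of_bool _)%:R); apply/idP/eqP => [|Xs].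
  by rewrite inE.
by rewrite inE.
Qed.

Lemma finite_valued_sum (g : S -> R) w : g (X w) = \sum_s g s * I s w.
Proof.
rewrite (bigD1 (X w))//= IE eqxx mulr1 big1 ?addr0// => s sX.
by rewrite IE eq_sym (negbTE sX) mulr0.
Qed.

Lemma finite_valued_Rintegral (g : S -> R) :
  \int[P]_w g (X w) = \sum_s g s * fine (P [set w | X w = s]).
Proof.
have iI s : P.-integrable setT (EFin \o (fun w => g s * I s w)).
  apply: (@bounded_integrable _ _ _ P _ `|g s|).
    exact: measurable_funM.
  by move=> w; rewrite normrM ler_piMr.
have H (r : seq S) : P.-integrable setT (EFin \o (fun w => \sum_(s <- r) g s * I s w)) /\
    \int[P]_w (\sum_(s <- r) g s * I s w) = \sum_(s <- r) g s * fine (P [set w | X w = s]).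
  elim: r => [|s r [ih1 ih2]].
    split.
      apply: (@bounded_integrable _ _ _ P _ 0) => [|w].
        rewrite (_ : (fun w => _) = cst 0); first exact: measurable_cst.
        by apply/funext => w; rewrite big_nil.
      by rewrite big_nil normr0.
    by under eq_Rintegral do rewrite big_nil; rewrite big_nil /Rintegral integral0.
  split.
    have := integrableD measurableT (iI s) ih1.
    by apply: eq_integrable => // w _ /=; rewrite big_cons EFinD.
  under eq_Rintegral do rewrite big_cons.
  rewrite big_cons RintegralD// ih2; congr (_ + _).
  have iIs : P.-integrable setT (EFin \o I s) by exact: (@bounded_integrable _ _ _ P _ 1).
  rewrite RintegralZl//; congr (_ * _).
  by rewrite /Rintegral /I integral_indic// setIT.
rewrite -(H (index_enum S)).2.
by apply: eq_Rintegral => w _; rewrite -finite_valued_sum.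
Qed.

Lemma sum_finite_law : \sum_s fine (P [set w | X w = s]) = 1.
Proof.
have := finite_valued_Rintegral (fun=> 1).
under [X in _ = X -> _]eq_bigr do rewrite mul1r.
move=> <-; transitivity (fine (1%:E * P setT)%E); first by rewrite /Rintegral integral_cst.
by rewrite probability_setT mule1.
Qed.

End simple.

Section independent_family.
Variables (M B : nat) (K : finType) (Y : K -> T -> 'cV[R]_M).
Hypothesis mY : forall k, rvec (Y k).
Hypothesis Yfin : forall k w i, exists2 j : nat, (j <= B)%N & Y k w i 0 = j%:R.
Hypothesis Yind : mutually_independent P Y.
Local Notation S := {ffun 'I_M -> 'I_B.+1}.

Definition count_vector (v : S) : 'cV[R]_M := \col_i (v i)%:R.

Lemma count_vector_inj : injective count_vector.
Proof.
move=> v v' /matrixP vv'; apply/ffunP => i; apply/val_inj/eqP.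
by have /eqP := vv' i 0; rewrite !mxE eqr_nat.
Qed.

(** Entries are integers between 0 and [B], so each vector factors through a finite type. *)
Lemma code_exists : exists code : K -> T -> S, forall k w, Y k w = count_vector (code k w).
Proof.
have H (kw : K * T) : exists v : S, Y kw.1 kw.2 = count_vector v.
  case: kw => k w /=.
  have [j Hj] := choice (fun i => let: ex_intro2 j h1 h2 := Yfin k w i in
    ex_intro (fun j : nat => (j <= B)%N /\ Y k w i 0 = j%:R) j (conj h1 h2)).
  exists [ffun i => inord (j i)]; apply/matrixP => i l; rewrite ord1 mxE ffunE.
  by have [h1 h2] := Hj i; rewrite inordK.
have [c Hc] := choice H; exists (fun k w => c (k, w)) => k w.
exact: (Hc (k, w)).
Qed.

(** Written as a rectangle of singletons, the kind of event to which [mutually_independent] applies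
    directly. *)
Definition value_event k (v : S) := rect_event (Y k) (fun i => [set count_vector v i 0]).
Definition value_law k (v : S) : R := fine (P (value_event k v)).

Lemma value_eventE k v : value_event k v = [set w | Y k w = count_vector v].
Proof.
rewrite predeqE => w; split => /= [H|H i]; last by rewrite /= H.
by apply/matrixP => i j; rewrite ord1; exact: H.
Qed.

Lemma measurable_value_event k v : measurable (value_event k v).
Proof.
have -> : value_event k v = \big[setI/setT]_(i <- index_enum 'I_M)
    [set w | Y k w i 0 = count_vector v i 0].
  rewrite -bigcap_seq predeqE => w; split => /= [H i _|H i]; first exact: H.
  by apply: H => /=; rewrite mem_index_enum.
apply: bigsetI_measurable => i _.
have mYi := mY k i.
have := mYi measurableT _ (measurable_set1 (count_vector v i 0)).
by rewrite setTI.
Qed.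

Lemma value_law_ge0 k v : 0 <= value_law k v.
Proof. by rewrite fine_ge0. Qed.

Lemma value_marginal k (F : 'cV[R]_M -> R) :
  \int[P]_w F (Y k w) = \sum_v F (count_vector v) * value_law k v.
Proof.
have [code codeE] := code_exists.
have eE v : [set w | code k w = v] = value_event k v.
  rewrite value_eventE predeqE => w /=; rewrite codeE.
  by split=> [->//|/count_vector_inj].
transitivity (\int[P]_w (F \o count_vector) (code k w)).
  by apply: eq_Rintegral => w _; rewrite codeE.
rewrite finite_valued_Rintegral; last by move=> v; rewrite eE; exact: measurable_value_event.
by apply: eq_bigr => v _; rewrite eE.
Qed.

Lemma sum_value_law k : \sum_v value_law k v = 1.
Proof.
have [code codeE] := code_exists.
have eE v : [set w | code k w = v] = value_event k v.
  rewrite value_eventE predeqE => w /=; rewrite codeE.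
  by split=> [->//|/count_vector_inj].
rewrite -(@sum_finite_law _ (code k)).
  by apply: eq_bigr => v _; rewrite eE.
by move=> v; rewrite eE; exact: measurable_value_event.
Qed.

(** Independence on rectangles of singletons makes the joint mass function of the codes equal to
    [prod_weight], reducing variance and characteristic function to the finite computations
    above. *)
Lemma value_joint (F : R -> R) (u : K -> 'cV[R]_M -> R) :
  \int[P]_w F (\sum_k u k (Y k w)) =
  \sum_(c : {ffun K -> S}) F (\sum_k u k (count_vector (c k))) * prod_weight value_law c.
Proof.
have [code codeE] := code_exists.
pose X w : {ffun K -> S} := [ffun k => code k w].
have eE c : [set w | X w = c] = \bigcap_(k in [set: K]) value_event k (c k).
  rewrite predeqE => w /=; split => [<- k _|H].
    by rewrite value_eventE/= ffunE codeE.
  apply/ffunP => k; rewrite ffunE; apply: count_vector_inj; rewrite -codeE.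
  by have := H k I; rewrite value_eventE.
have mE c : measurable [set w | X w = c].
  have -> : [set w | X w = c] = \big[setI/setT]_(k <- index_enum K) value_event k (c k).
    rewrite eE -bigcap_seq predeqE => w; split => H k _; apply: H => //=.
    by rewrite mem_index_enum.
  by apply: bigsetI_measurable => k _; exact: measurable_value_event.
transitivity (\int[P]_w (fun c : {ffun K -> S} => F (\sum_k u k (count_vector (c k)))) (X w)).
  apply: eq_Rintegral => w _; congr F; apply: eq_bigr => k _.
  by rewrite ffunE codeE.
rewrite (finite_valued_Rintegral mE (fun c => F (\sum_k u k (count_vector (c k))))).
apply: eq_bigr => c _; congr (_ * _).
rewrite eE Yind; last by move=> k i; exact: measurable_set1.
rewrite /prod_weight /value_law.
rewrite (eq_bigr (fun k => (fine (P (value_event k (c k))))%:E)); last first.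
  by move=> k _; rewrite fineK// fin_num_measure//; exact: measurable_value_event.
by rewrite prodEFin.
Qed.

Lemma value_Rintegral_sum k (I : Type) (r : seq I) (F : I -> 'cV[R]_M -> R) :
  \int[P]_w (\sum_(i <- r) F i (Y k w)) = \sum_(i <- r) \int[P]_w F i (Y k w).
Proof.
rewrite (value_marginal k (fun y => \sum_(i <- r) F i y)).
under [RHS]eq_bigr do rewrite value_marginal.
by rewrite exchange_big/=; apply: eq_bigr => v _; rewrite mulr_suml.
Qed.

Lemma value_RintegralZ k (a : R) (F : 'cV[R]_M -> R) :
  \int[P]_w (a * F (Y k w)) = a * \int[P]_w F (Y k w).
Proof.
rewrite (value_marginal k (fun y => a * F y)) value_marginal mulr_sumr.
by apply: eq_bigr => v _; rewrite mulrA.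
Qed.

Lemma value_RintegralB k (a : R) (F : 'cV[R]_M -> R) :
  \int[P]_w (F (Y k w) - a) = \int[P]_w F (Y k w) - a.
Proof.
rewrite (value_marginal k (fun y => F y - a)) value_marginal.
under eq_bigr do rewrite mulrBl.
by rewrite sumrB -mulr_sumr sum_value_law mulr1.
Qed.

Lemma indep_variance (u : K -> 'cV[R]_M -> R) :
  (forall k, \int[P]_w u k (Y k w) = 0) ->
  \int[P]_w (\sum_k u k (Y k w)) ^+ 2 = \sum_k \int[P]_w u k (Y k w) ^+ 2.
Proof.
move=> u0.
rewrite (value_joint (fun x => x ^+ 2)).
rewrite (@prod_weight_variance _ _ _ value_law sum_value_law (fun k v => u k (count_vector v))).
  by apply: eq_bigr => k _; rewrite (value_marginal k (fun y => u k y ^+ 2)).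
by move=> k; rewrite -value_marginal.
Qed.

Lemma indep_charfun (u : K -> 'cV[R]_M -> R) (sg : K -> R) (eta : R) : 0 <= eta <= 1 ->
  (forall k v, `|u k (count_vector v)| <= eta) ->
  (forall k, \int[P]_w u k (Y k w) = 0) ->
  (forall k, \int[P]_w u k (Y k w) ^+ 2 = sg k) ->
  `|\int[P]_w cos (\sum_k u k (Y k w)) - expR (- (\sum_k sg k) / 2)| <= #|K|%:R * (3 * eta ^+ 3) /\
  `|\int[P]_w sin (\sum_k u k (Y k w))| <= #|K|%:R * (3 * eta ^+ 3).
Proof.
move=> eta01 ueta u0 u2; rewrite (value_joint cos u) (value_joint sin u).
apply: (charfun_bound value_law_ge0 sum_value_law (xi := fun k v => u k (count_vector v))) => //.
- by move=> k; rewrite -value_marginal.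
- by move=> k; rewrite -u2 (value_marginal k (fun y => u k y ^+ 2)).
Qed.

End independent_family.
End finite_law.

(** * Asymptotics of the empirical proportions *)

Section residual_covariance.
Variables (R : realType) (M M0 : nat) (W : 'M[R]_(M, M0)).
Hypothesis M_gt0 : (0 < M)%N.
Hypothesis W1_free : \rank (row_mx (const_mx 1 : 'cV[R]_M) W) = M0.+1.
Variable theta0 : 'cV[R]_M0.
Local Notation S := (Sigmap (ploglin W theta0)).

Lemma Sigmap_sym (p : 'cV[R]_M) : (Sigmap p)^T = Sigmap p.
Proof.
by rewrite /Sigmap /Dp linearB/= tr_diag_mx trmx_mul trmxK.
Qed.

(** With [X = S W H^-1 W^T], the matrix [(1 - X) S] annihilates [W], and [X^T] starts with [W].
    Hence [(1 - X) S (1 - X)^T = (1 - X) S]. *)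
Lemma residual_covariance :
  residual_mx W theta0 *m S *m (residual_mx W theta0)^T =
  S - S *m W *m invmx (W^T *m S *m W) *m W^T *m S.
Proof.
have Hu := information_unit M_gt0 W1_free theta0.
rewrite /residual_mx; set H := W^T *m S *m W in Hu *.
have HiS : (invmx H)^T = invmx H.
  by rewrite trmx_inv /H !trmx_mul trmxK Sigmap_sym mulmxA.
have SW0 : (S - S *m W *m invmx H *m W^T *m S) *m W = 0.
  rewrite mulmxBl -!mulmxA (mulmxA W^T) -/H mulVmx// mulmx1 subrr//.
set X := S *m W *m invmx H *m W^T in SW0 *.
have XT : X^T = W *m (invmx H *m (W^T *m S)).
  by rewrite /X !trmx_mul trmxK HiS Sigmap_sym !mulmxA.
have trB : (1%:M - X)^T = 1%:M - X^T by rewrite linearB/= trmx1.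
have E1 : (1%:M - X) *m S = S - X *m S by rewrite mulmxBl mul1mx.
by rewrite trB E1 mulmxBr mulmx1 XT mulmxA SW0 mul0mx subr0.
Qed.

End residual_covariance.

Section tail.
Context (R : realType) d (T : measurableType d) (P : probability T R) (M : nat).

(** Chebyshev's inequality: the maximum norm exceeds [K] only if the sum of squared coordinates
    exceeds [K^2]. The bound [C] provides integrability. *)
Lemma second_moment_tail (V : T -> 'cV[R]_M) (C s K : R) : rvec V ->
  (forall w, `|V w| <= C) -> (forall i, \int[P]_w (V w i 0) ^+ 2 <= s) -> 0 < K ->
  fine (P [set w | K < `|V w|]) <= M%:R * s / K ^+ 2.
Proof.
move=> mV VC Vs K0.
have mA := rvec_norm_measurable K mV.
have -> : fine (P [set w | K < `|V w|]) = \int[P]_w (\1_[set w | K < `|V w|] w : R).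
  by rewrite /Rintegral integral_indic// setIT.
have mVi i : measurable_fun setT (fun w => (V w i 0) ^+ 2).
  by apply: measurable_funX; exact: mV.
have Vi w i : `|(V w i 0) ^+ 2| <= C ^+ 2.
  have Vi := le_trans (mxentry_le_norm (V w) i 0) (VC w).
  by rewrite normrX lerXn2r// nnegrE// (le_trans _ Vi).
have iV i := bounded_integrable P (mVi i) (fun w => Vi w i).
have I (r : seq 'I_M) : P.-integrable setT (EFin \o (fun w => \sum_(i <- r) (V w i 0) ^+ 2)) /\
    \int[P]_w (\sum_(i <- r) (V w i 0) ^+ 2) = \sum_(i <- r) \int[P]_w (V w i 0) ^+ 2.
  elim: r => [|i r [ih1 ih2]].
    split.
      apply: (@bounded_integrable _ _ _ P _ 0) => [|w].
        rewrite (_ : (fun w => _) = cst 0); first exact: measurable_cst.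
        by apply/funext => w; rewrite big_nil.
      by rewrite big_nil normr0.
    by under eq_Rintegral do rewrite big_nil; rewrite big_nil /Rintegral integral0.
  split.
    have := integrableD measurableT (iV i) ih1.
    by apply: eq_integrable => // w _ /=; rewrite big_cons EFinD.
  under eq_Rintegral do rewrite big_cons.
  by rewrite big_cons RintegralD// ih2.
have [iS ES] := I (index_enum 'I_M).
apply: (@le_trans _ _ (\int[P]_w (K ^- 2 * \sum_i (V w i 0) ^+ 2))).
  apply: le_Rintegral => //.
  - apply: (@bounded_integrable _ _ _ P _ 1); first exact: measurable_indic.
    by move=> w; rewrite indicE; case: (w \in _); rewrite ?normr1 ?normr0.
  - have := integrableZl measurableT (K ^- 2) iS.
    by apply: eq_integrable => // w _ /=; rewrite EFinM.
  - move=> w _; rewrite indicE.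
    have S0 : 0 <= \sum_i V w i 0 ^+ 2 by apply: sumr_ge0 => i _; exact: sqr_ge0.
    have [|_] := boolP (w \in _); last by rewrite mulr_ge0// invr_ge0 exprn_ge0// ltW.
    rewrite inE/= => KV; rewrite mulrC ler_pdivlMr ?exprn_gt0// mul1r.
    rewrite leNgt; apply/negP => SK; move: KV; rewrite ltNge => /negP; apply.
    apply: mxnorm_leP; first exact: ltW.
    move=> i j; rewrite ord1 -(@ler_pXn2r _ 2)// ?nnegrE// ?(ltW K0)//.
    rewrite real_normK ?num_real// (le_trans _ (ltW SK))//.
    by rewrite (bigD1 i)//= lerDl sumr_ge0// => k _; exact: sqr_ge0.
rewrite RintegralZl// ES [leRHS]mulrC ler_wpM2l ?invr_ge0 ?exprn_ge0 ?(ltW K0)//.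
apply: le_trans (ler_sum _ (fun i _ => Vs i)) _.
by rewrite sumr_const card_ord mulr_natl.
Qed.

End tail.

(** * Central limit theorem for the empirical proportions *)

Section asymptotics.
Context (R : realType) d (T : measurableType d) (P : probability T R).
Variables (M M0 : nat) (W : 'M[R]_(M, M0)) (G : nat) (n : 'I_G -> nat).
Variables (Ng : nat -> 'I_G -> nat) (Nstar : 'I_G -> R) (rho2 : R).
Variables (theta0 : 'cV[R]_M0) (Y : nat -> forall g : 'I_G, nat -> T -> 'cV[R]_M).
Local Notation p0 := (ploglin W theta0).
Hypothesis M_gt0 : (0 < M)%N.
Hypothesis n_gt0 : forall g, (0 < n g)%N.
Hypothesis sum_Ng : forall N, (\sum_(g < G) Ng N g)%N = N.
Hypothesis Nstar_gt0 : forall g, 0 < Nstar g.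
Hypothesis cvg_Ng : forall g, ((Ng N g)%:R / N%:R : R) @[N --> \oo] --> Nstar g.
Hypothesis mY : forall N g l, (l < Ng N g)%N -> rvec (Y N g l).
Hypothesis Y_nat : forall N g l w i, (l < Ng N g)%N -> exists k : nat, Y N g l w i 0 = k%:R.
Hypothesis Y_sum : forall N g l w, (l < Ng N g)%N -> \sum_(i < M) Y N g l w i 0 = (n g)%:R.
Hypothesis Y_indep : forall N, mutually_independent P
  (fun gl : {g : 'I_G & 'I_(Ng N g)} => Y N (projT1 gl) (projT2 gl)).
Hypothesis Y_mean : forall N g l i, (l < Ng N g)%N ->
  (\int[P]_w (Y N g l w i 0)%:E = ((n g)%:R * p0 i 0)%:E)%E.
Hypothesis Y_cov : forall N g l i j, (l < Ng N g)%N ->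
  (\int[P]_w ((Y N g l w i 0 - (n g)%:R * p0 i 0) * (Y N g l w j 0 - (n g)%:R * p0 j 0))%:E
   = ((1 + ((n g)%:R - 1) * rho2) * (n g)%:R * Sigmap p0 i j)%:E)%E.

Definition total_size N : R := \sum_(h < G) ((n h)%:R * (Ng N h)%:R).
Definition phat N w : 'cV[R]_M :=
  (total_size N)^-1 *: \sum_(g < G) \sum_(l < Ng N g) Y N g l w.
Definition scaled_error N w : 'cV[R]_M := Num.sqrt N%:R *: (phat N w - p0).
Local Notation K N := {g : 'I_G & 'I_(Ng N g)}.
Local Notation vth g := (1 + ((n g)%:R - 1) * rho2).
(** A bound on counts common to all groups, so that one finite value type serves every cluster. *)
Let B := (\sum_g n g)%N.

(** The contribution of one cluster to [dot t (scaled_error N w)], as [scaled_error_dot] shows. *)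
Definition cluster_score N (t : 'cV[R]_M) (gl : K N) (y : 'cV[R]_M) : R :=
  Num.sqrt N%:R / total_size N * \sum_i t i 0 * (y i 0 - (n (projT1 gl))%:R * p0 i 0).

Lemma n_le_B g : (n g <= B)%N.
Proof. by rewrite /B (bigD1 g)//= leq_addr. Qed.

Lemma total_size_ge N : N%:R <= total_size N.
Proof.
rewrite -{1}(sum_Ng N) natr_sum; apply: ler_sum => g _.
by rewrite -[leLHS]mul1r ler_wpM2r// ler1n.
Qed.

Lemma sum_clusters N (f : forall g, 'I_(Ng N g) -> R) :
  \sum_(gl : K N) f (projT1 gl) (projT2 gl) = \sum_g \sum_l f g l.
Proof. by rewrite sig_big_dep/=. Qed.

Lemma sum_clusters_cst N (f : 'I_G -> R) :
  \sum_(gl : K N) f (projT1 gl) = \sum_g (Ng N g)%:R * f g.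
Proof.
rewrite (sum_clusters (fun g _ => f g)); apply: eq_bigr => g _.
by rewrite sumr_const card_ord mulr_natl.
Qed.

Lemma card_clusters N : #|{: K N}| = N.
Proof.
apply/eqP; rewrite -(eqr_nat R) -sum1_card natr_sum.
rewrite (sum_clusters_cst N (fun=> 1)) -{2}(sum_Ng N) natr_sum; apply/eqP.
by apply: eq_bigr => g _; rewrite mulr1.
Qed.

Lemma Y_values N (gl : K N) w i :
  exists2 j : nat, (j <= B)%N & Y N (projT1 gl) (projT2 gl) w i 0 = j%:R.
Proof.
case: gl => g l /=; have [j jE] := Y_nat w i (ltn_ord l).
exists j => //; apply: leq_trans (n_le_B g).
rewrite -(ler_nat R) -jE -(Y_sum w (ltn_ord l)) (bigD1 i)//= lerDl.
by apply: sumr_ge0 => k _; have [j' ->] := Y_nat w k (ltn_ord l).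
Qed.

Lemma mYK N (gl : K N) : rvec (Y N (projT1 gl) (projT2 gl)).
Proof. exact: mY. Qed.

Lemma phat_entry N w i : phat N w i 0 =
  (total_size N)^-1 * \sum_(gl : K N) Y N (projT1 gl) (projT2 gl) w i 0.
Proof.
rewrite mxE summxE (sum_clusters (fun g l => Y N g l w i 0)); congr (_ * _).
by apply: eq_bigr => g _; rewrite summxE.
Qed.

Lemma sum_phat N w : (0 < N)%N -> \sum_i phat N w i 0 = 1.
Proof.
move=> N0; under eq_bigr do rewrite phat_entry.
rewrite -mulr_sumr exchange_big/=.
under eq_bigr => gl _ do rewrite Y_sum//.
rewrite (sum_clusters_cst N (fun g => (n g)%:R)).
under eq_bigr do rewrite mulrC.
by rewrite mulVf// gt_eqF// (lt_le_trans _ (total_size_ge N))// ltr0n.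
Qed.

Lemma scaled_error_dot N t w : (0 < N)%N ->
  dot t (scaled_error N w) = \sum_(gl : K N) cluster_score t gl (Y N (projT1 gl) (projT2 gl) w).
Proof.
move=> N0.
have A0 : total_size N != 0.
  by rewrite gt_eqF// (lt_le_trans _ (total_size_ge N))// ltr0n.
rewrite dotE /cluster_score -mulr_sumr exchange_big/= mulr_sumr.
apply: eq_bigr => i _.
rewrite -mulr_sumr sumrB -mulr_suml (sum_clusters_cst N (fun g => (n g)%:R)).
have -> : \sum_g (Ng N g)%:R * (n g)%:R = total_size N.
  by apply: eq_bigr => g _; rewrite mulrC.
rewrite /scaled_error mxE entryB phat_entry.
by field.
Qed.

Lemma cluster_score_mean N t (gl : K N) :
  \int[P]_w cluster_score t gl (Y N (projT1 gl) (projT2 gl) w) = 0.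
Proof.
rewrite /cluster_score.
have Z := value_RintegralZ P (@mYK N) (@Y_values N) gl.
rewrite (Z _ (fun y => \sum_i t i 0 * (y i 0 - (n (projT1 gl))%:R * p0 i 0))).
have Sm := value_Rintegral_sum P (@mYK N) (@Y_values N) gl (index_enum 'I_M).
rewrite (Sm (fun i y => t i 0 * (y i 0 - (n (projT1 gl))%:R * p0 i 0))).
rewrite big1 ?mulr0// => i _.
rewrite (Z _ (fun y => y i 0 - (n (projT1 gl))%:R * p0 i 0)).
have Bm := value_RintegralB P (@mYK N) (@Y_values N) gl.
rewrite (Bm _ (fun y => y i 0)).
by rewrite /Rintegral Y_mean//= subrr mulr0.
Qed.

Lemma cluster_score_var N t (gl : K N) :
  \int[P]_w cluster_score t gl (Y N (projT1 gl) (projT2 gl) w) ^+ 2 =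
  N%:R / total_size N ^+ 2 * (vth (projT1 gl) * (n (projT1 gl))%:R * dot t (Sigmap p0 *m t)).
Proof.
have Z := value_RintegralZ P (@mYK N) (@Y_values N) gl.
have Sm := value_Rintegral_sum P (@mYK N) (@Y_values N) gl (index_enum 'I_M).
set g := projT1 gl; set l := projT2 gl.
pose z (y : 'cV[R]_M) i := y i 0 - (n g)%:R * p0 i 0.
transitivity (\int[P]_w (N%:R / total_size N ^+ 2 *
    \sum_i \sum_j t i 0 * t j 0 * (z (Y N g l w) i * z (Y N g l w) j))).
  apply: eq_Rintegral => w _; rewrite /cluster_score -/g exprMn expr_div_n sqr_sqrtr//.
  congr (_ * _); rewrite expr2 big_distrlr/=; apply: eq_bigr => i _; apply: eq_bigr => j _.
  by rewrite /z; ring.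
rewrite (Z _ (fun y => \sum_i \sum_j t i 0 * t j 0 * (z y i * z y j))).
congr (_ * _).
rewrite (Sm (fun i y => \sum_j t i 0 * t j 0 * (z y i * z y j))).
transitivity (\sum_i \sum_j t i 0 * t j 0 * (vth g * (n g)%:R * Sigmap p0 i j)).
  apply: eq_bigr => i _.
  rewrite (Sm (fun j y => t i 0 * t j 0 * (z y i * z y j))); apply: eq_bigr => j _.
  rewrite (Z _ (fun y => z y i * z y j)); congr (_ * _).
  by rewrite /Rintegral /z Y_cov.
rewrite dotE mulr_sumr; apply: eq_bigr => i _.
rewrite [(Sigmap p0 *m t) i 0]mxE !mulr_sumr; apply: eq_bigr => j _; ring.
Qed.

Definition score_bound (t : 'cV[R]_M) : R := \sum_i `|t i 0| * (2 * B%:R).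

Lemma score_bound_ge0 t : 0 <= score_bound t.
Proof. by apply: sumr_ge0 => i _; rewrite !mulr_ge0. Qed.

(** The total size is at least [N], so the prefactor is at most [1 / sqrt N]; the counts and their
    means both lie between 0 and [B]. The resulting order plays the role of [eta]. *)
Lemma cluster_score_bound N t (gl : K N) (v : {ffun 'I_M -> 'I_B.+1}) : (0 < N)%N ->
  `|cluster_score t gl (count_vector R v)| <= score_bound t / Num.sqrt N%:R.
Proof.
move=> N0; have N0' : 0 < N%:R :> R by rewrite ltr0n.
have A0 := lt_le_trans N0' (total_size_ge N).
have sN : 0 < Num.sqrt N%:R :> R by rewrite sqrtr_gt0.
rewrite /cluster_score normrM mulrC; apply: ler_pM => //.
  apply: le_trans (ler_norm_sum _ _ _) _; apply: ler_sum => i _.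
  rewrite normrM ler_wpM2l// mxE.
  apply: le_trans (ler_normB _ _) _.
  have -> : 2 * B%:R = B%:R + B%:R :> R by ring.
  apply: lerD; first by rewrite ger0_norm// ler_nat -ltnS.
  have p_gt0 := ploglin_gt0 W M_gt0 theta0.
  rewrite ger0_norm ?mulr_ge0 ?(ltW (p_gt0 i))// -[leRHS]mulr1 ler_pM ?(ltW (p_gt0 i))//.
    by rewrite ler_nat n_le_B.
  rewrite -(sum_ploglin W M_gt0 theta0) (bigD1 i)//= lerDl; apply: sumr_ge0 => k _.
  exact: ltW.
rewrite ger0_norm ?divr_ge0 ?(ltW A0)// ler_pdivrMr// mulrC ler_pdivlMr//.
by rewrite -expr2 sqr_sqrtr// total_size_ge.
Qed.

Lemma cluster_score_bound_Y N t (gl : K N) w : (0 < N)%N ->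
  `|cluster_score t gl (Y N (projT1 gl) (projT2 gl) w)| <= score_bound t / Num.sqrt N%:R.
Proof.
move=> N0; have [code codeE] := code_exists (@Y_values N).
by rewrite (codeE gl w); exact: cluster_score_bound.
Qed.

Lemma rvec_phat N : rvec (phat N).
Proof.
move=> i; under eq_fun do rewrite phat_entry.
apply: measurable_funM => //; apply: measurable_sum => gl; exact: mYK.
Qed.

Lemma rvec_scaled_error N : rvec (scaled_error N).
Proof.
move=> i.
have -> : (fun w => scaled_error N w i 0) = (fun w => Num.sqrt N%:R * (phat N w i 0 - p0 i 0)).
  by apply/funext => w; rewrite /scaled_error mxE entryB.
apply: measurable_funM => //; apply: measurable_funB => //; exact: rvec_phat.
Qed.

Lemma dot_delta i (x : 'cV[R]_M) : dot (delta_mx i 0) x = x i 0.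
Proof.
rewrite dotE (bigD1 i)//= big1 ?addr0; first by rewrite mxE !eqxx mul1r.
by move=> j ji; rewrite mxE (negbTE ji) mul0r.
Qed.

Lemma tight_scaled_error : tight P scaled_error.
Proof.
move=> e e0.
pose L := \sum_i score_bound (delta_mx i 0).
have Li i : score_bound (delta_mx i 0) <= L.
  by rewrite /L (bigD1 i)//= lerDl sumr_ge0// => k _; exact: score_bound_ge0.
have L0 : 0 <= L by apply: sumr_ge0 => i _; exact: score_bound_ge0.
pose c := M%:R * L ^+ 2.
have c0 : 0 <= c by rewrite mulr_ge0// sqr_ge0.
(* Since [Q >= 1] and [Q >= c/e], Chebyshev's bound [c / Q^2] is at most [e]. *)
pose Q := c / e + 1.
have Q1 : 1 <= Q by rewrite lerDr divr_ge0// ltW.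
have Q0 : 0 < Q by exact: lt_le_trans Q1.
exists Q => //; near=> N.
have N0 : (0 < N)%N by near: N; exact: nbhs_infty_gt.
have sN : 0 < Num.sqrt N%:R :> R by rewrite sqrtr_gt0 ltr0n.
have coord w i : scaled_error N w i 0 =
    \sum_(gl : K N) cluster_score (delta_mx i 0) gl (Y N (projT1 gl) (projT2 gl) w).
  by rewrite -scaled_error_dot// dot_delta.
have bd i (gl : K N) w : `|cluster_score (delta_mx i 0) gl (Y N (projT1 gl) (projT2 gl) w)| <= L / Num.sqrt N%:R.
  apply: le_trans (cluster_score_bound_Y (delta_mx i 0) gl w N0) _.
  by rewrite ler_wpM2r// invr_ge0 ltW.
have := @second_moment_tail _ _ _ P _ (scaled_error N) (N%:R * (L / Num.sqrt N%:R)) (L ^+ 2) Q.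
move=> /(_ (@rvec_scaled_error N)) H.
apply: (@le_trans _ _ (M%:R * L ^+ 2 / Q ^+ 2)).
  apply: H => //.
    move=> w; apply: mxnorm_leP; first by rewrite mulr_ge0// divr_ge0// ltW.
    move=> i j; rewrite ord1 coord; apply: le_trans (ler_norm_sum _ _ _) _.
    apply: le_trans (ler_sum _ (fun gl _ => bd i gl w)) _.
    by rewrite sumr_const card_clusters mulr_natl.
  move=> i; under eq_Rintegral do rewrite coord.
  rewrite (indep_variance (@mYK N) (@Y_values N) (@Y_indep N)); last exact: cluster_score_mean.
  (* The crude bound by the squared maximum suffices for tightness: [N] terms of size [L^2 / N] sum
     to [L^2]. *)
  have le1 (gl : K N) : \int[P]_w cluster_score (delta_mx i 0) gl (Y N (projT1 gl) (projT2 gl) w) ^+ 2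
      <= L ^+ 2 / N%:R.
    rewrite (value_marginal P (@mYK N) (@Y_values N) gl (fun y => cluster_score (delta_mx i 0) gl y ^+ 2)).
    have law1 := sum_value_law P (@mYK N) (@Y_values N) gl.
    rewrite -[leRHS]mulr1 -[X in _ <= _ * X]law1 mulr_sumr.
    apply: ler_sum => v _; rewrite ler_wpM2r ?value_law_ge0//.
    have := le_trans (cluster_score_bound (delta_mx i 0) gl v N0)
      (ler_wpM2r _ (Li i) : _ <= L / Num.sqrt N%:R).
    rewrite invr_ge0 => /(_ (ltW sN)) b1.
    rewrite -[leLHS]real_normK ?num_real//.
    have -> : L ^+ 2 / N%:R = (L / Num.sqrt N%:R) ^+ 2 by rewrite expr_div_n sqr_sqrtr.
    by rewrite lerXn2r// nnegrE divr_ge0// ltW.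
  apply: le_trans (ler_sum _ (fun gl _ => le1 gl)) _.
  rewrite sumr_const card_clusters -[_ *+ N]mulr_natl mulrCA mulfV ?mulr1//.
  by rewrite pnatr_eq0 -lt0n.
rewrite -/c ler_pdivrMr ?exprn_gt0//.
have cQ : c <= e * Q by rewrite /Q mulrDr mulr1 mulrCA mulfV ?gt_eqF// mulr1 lerDl ltW.
apply: le_trans cQ _; rewrite ler_pM2l// expr2 ler_peMr// ltW.
Unshelve. all: by end_near. Qed.

Let nbar := \sum_g Nstar g * (n g)%:R.
Let nstar := \sum_g Nstar g * (n g)%:R / nbar * (n g)%:R.

Definition score_variance N (tau : R) :=
  N%:R / total_size N ^+ 2 * ((\sum_g (Ng N g)%:R * (vth g * (n g)%:R)) * tau).

Lemma nbar_gt0 : 0 < nbar.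
Proof.
(* Without groups the number of clusters at stage 1 would be 0 instead of 1. *)
have G0 : (0 < G)%N.
  by move: (sum_Ng 1); case: (G) Ng => // N1; rewrite big_ord0.
rewrite /nbar (bigD1 (Ordinal G0))//= ltr_pwDl//.
  by rewrite mulr_gt0// ltr0n.
by apply: sumr_ge0 => g _; rewrite mulr_ge0// ltW.
Qed.

(** Dividing by [N] throughout turns the variance into [a N / b N ^ 2 * tau], whose ingredients are
    finite sums of the convergent frequencies. *)
Lemma score_variance_cvg tau :
  score_variance N tau @[N --> \oo] --> (1 + rho2 * (nstar - 1)) / nbar * tau.
Proof.
have nb0 : nbar != 0 by rewrite gt_eqF// nbar_gt0.
pose a N : R := \sum_g (Ng N g)%:R / N%:R * (vth g * (n g)%:R).
pose b N : R := \sum_g (Ng N g)%:R / N%:R * (n g)%:R.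
have ca : a N @[N --> \oo] --> \sum_g Nstar g * (vth g * (n g)%:R).
  by apply: cvg_bigsum => g; apply: cvgM; [exact: cvg_Ng|exact: cvg_cst].
have cb : b N @[N --> \oo] --> nbar.
  by apply: cvg_bigsum => g; apply: cvgM; [exact: cvg_Ng|exact: cvg_cst].
have lE : (1 + rho2 * (nstar - 1)) / nbar * tau =
    (\sum_g Nstar g * (vth g * (n g)%:R)) / nbar ^+ 2 * tau.
  (* The sum of [Nstar g * n g ^ 2] is [nstar * nbar]; this is where the size-weighted mean [nstar]
     arises. *)
  have -> : \sum_g Nstar g * (vth g * (n g)%:R) = nbar + rho2 * (nstar * nbar - nbar).
    have -> : nstar * nbar = \sum_g Nstar g * (n g)%:R * (n g)%:R.
      by rewrite /nstar mulr_suml; apply: eq_bigr => g _; field.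
    rewrite /nbar -sumrB mulr_sumr -big_split/=.
    by apply: eq_bigr => g _; ring.
  by field.
rewrite lE.
have H : a N / b N ^+ 2 * tau @[N --> \oo] --> (\sum_g Nstar g * (vth g * (n g)%:R)) / nbar ^+ 2 * tau.
  apply: cvgM; last exact: cvg_cst.
  apply: cvgM => //; apply: cvgV; first by rewrite expf_neq0.
  have -> : (fun N => b N ^+ 2) = (fun N => b N * b N) by apply/funext => N; rewrite expr2.
  by rewrite expr2; exact: cvgM.
apply: cvg_trans H; apply: near_eq_cvg; near=> N.
have N0 : N%:R != 0 :> R by rewrite pnatr_eq0 -lt0n; near: N; exact: nbhs_infty_gt.
have A0 : total_size N != 0.
  rewrite gt_eqF// (lt_le_trans _ (total_size_ge N))//.
  by rewrite lt_neqAle eq_sym N0/=.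
have aE : a N = (\sum_g (Ng N g)%:R * (vth g * (n g)%:R)) / N%:R.
  by rewrite /a mulr_suml; apply: eq_bigr => g _; field.
have bE : b N = total_size N / N%:R.
  by rewrite /b /total_size mulr_suml; apply: eq_bigr => g _; field.
rewrite /score_variance aE bE.
by field; rewrite ?A0 ?N0.
Unshelve. all: by end_near. Qed.

Lemma cvg_charfun t :
  (\int[P]_w cos (dot t (scaled_error N w))) @[N --> \oo] -->
    expR (- ((1 + rho2 * (nstar - 1)) / nbar * dot t (Sigmap p0 *m t)) / 2) /\
  (\int[P]_w sin (dot t (scaled_error N w))) @[N --> \oo] --> (0 : R).
Proof.
pose L := score_bound t.
have L0 : 0 <= L by exact: score_bound_ge0.
pose tau := dot t (Sigmap p0 *m t).
(* This is [N * 3 eta^3] with [eta = L / sqrt N]. *)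
pose err N : R := 3 * L ^+ 3 / Num.sqrt N%:R.
have sq_cvg (e : R) : 0 < e -> \forall N \near \oo, err N <= e.
  move=> e0; near=> N.
  have N0 : (0 < N)%N by near: N; exact: nbhs_infty_gt.
  rewrite /err ler_pdivrMr ?sqrtr_gt0 ?ltr0n// -ler_pdivrMl//.
  set q := e^-1 * _.
  have q0 : 0 <= q by rewrite mulr_ge0 ?invr_ge0 ?(ltW e0)// mulr_ge0// exprn_ge0.
  rewrite -(ger0_norm q0) -sqrtr_sqr ler_sqrt ?ler0n//.
  by near: N; exact: nbhs_infty_ger.
have bound : \forall N \near \oo,
   `|\int[P]_w cos (dot t (scaled_error N w)) - expR (- score_variance N tau / 2)| <= err N /\
   `|\int[P]_w sin (dot t (scaled_error N w))| <= err N.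
  near=> N.
  have N0 : (0 < N)%N by near: N; exact: nbhs_infty_gt.
  have sN : 0 < Num.sqrt N%:R :> R by rewrite sqrtr_gt0 ltr0n.
  have eta01 : 0 <= L / Num.sqrt N%:R <= 1.
    rewrite divr_ge0 ?(ltW sN)//= ler_pdivrMr// mul1r -(ger0_norm L0) -sqrtr_sqr.
    by rewrite ler_sqrt ?ler0n//; near: N; exact: nbhs_infty_ger.
  have [] := indep_charfun (@mYK N) (@Y_values N) (@Y_indep N) eta01
    (fun gl v => cluster_score_bound t gl v N0) (cluster_score_mean t) (cluster_score_var t).
  rewrite card_clusters.
  have -> : N%:R * (3 * (L / Num.sqrt N%:R) ^+ 3) = err N.
    rewrite /err; set s := Num.sqrt _ in sN *.
    have -> : N%:R = s ^+ 2 by rewrite sqr_sqrtr.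
    by field; rewrite gt_eqF.
  have -> : \sum_(gl : K N) N%:R / total_size N ^+ 2 *
      (vth (projT1 gl) * (n (projT1 gl))%:R * tau) = score_variance N tau.
    rewrite -mulr_sumr -mulr_suml /score_variance; congr (_ * (_ * _)).
    exact: (sum_clusters_cst N (fun g => vth g * (n g)%:R)).
  have sE w := scaled_error_dot t w N0.
  have -> : \int[P]_w cos (dot t (scaled_error N w)) =
      \int[P]_w cos (\sum_(gl : K N) cluster_score t gl (Y N (projT1 gl) (projT2 gl) w)).
    by apply: eq_Rintegral => w _; rewrite sE.
  have -> : \int[P]_w sin (dot t (scaled_error N w)) =
      \int[P]_w sin (\sum_(gl : K N) cluster_score t gl (Y N (projT1 gl) (projT2 gl) w)).
    by apply: eq_Rintegral => w _; rewrite sE.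
  by [].
have cvE : expR (- score_variance N tau / 2) @[N --> \oo] -->
    expR (- ((1 + rho2 * (nstar - 1)) / nbar * tau) / 2).
  apply: continuous_cvg; first exact: continuous_expR.
  apply: cvgM; last exact: cvg_cst.
  by apply: cvgN; exact: score_variance_cvg.
split; apply/cvgrPdist_le => e e0.
  have e2 : 0 < e / 2 by rewrite divr_gt0.
  move/cvgrPdist_le : cvE => /(_ _ e2) H1; have H2 := sq_cvg _ e2.
  near=> N.
  have h1 : `|expR (- ((1 + rho2 * (nstar - 1)) / nbar * tau) / 2) -
     expR (- score_variance N tau / 2)| <= e / 2 by near: N.
  have [h2 _] : `|\int[P]_w cos (dot t (scaled_error N w)) - expR (- score_variance N tau / 2)| <= err N /\
   `|\int[P]_w sin (dot t (scaled_error N w))| <= err N by near: N.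
  have h3 : err N <= e / 2 by near: N.
  move: h1 h2 h3; rewrite -/tau.
  move: (expR _) (expR _) (\int[P]_w _) (err N) => a b c' f.
  rewrite !ler_norml => /andP[? ?] /andP[? ?] ?; apply/andP; split; lra.
have H2 := sq_cvg _ e0.
near=> N.
have [_ h2] : `|\int[P]_w cos (dot t (scaled_error N w)) - expR (- score_variance N tau / 2)| <= err N /\
   `|\int[P]_w sin (dot t (scaled_error N w))| <= err N by near: N.
rewrite sub0r normrN; apply: le_trans h2 _.
by near: N.
Unshelve. all: by end_near. Qed.

End asymptotics.

(** * Passage to the estimated residual and conclusion *)

Section estimator_limit.
Variable R : realType.

Lemma dot_mulmx (M : nat) (A : 'M[R]_M) (t x : 'cV[R]_M) : dot t (A *m x) = dot (A^T *m t) x.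
Proof. by rewrite /dot trmx_mul trmxK mulmxA. Qed.

Lemma ploglin_le1 (M M0 : nat) (W : 'M[R]_(M, M0)) theta i : (0 < M)%N ->
  `|ploglin W theta i 0| <= 1.
Proof.
move=> M0'; have p_gt0 := ploglin_gt0 W M0' theta.
rewrite gtr0_norm// -(sum_ploglin W M0' theta) (bigD1 i)//= lerDl; apply: sumr_ge0 => k _.
exact: ltW.
Qed.

(** On [|sqrt(N) x| <= K] the deviation [x] is at most [K / sqrt N], eventually below the radius of
    [residual_expansion]. There a minimizer exists, so [thetahat] is one, and the relative error
    [e / (2K)] becomes at most [e/2] after scaling. *)
Lemma residual_close (T : Type) (M M0 : nat) (W : 'M[R]_(M, M0)) (phi : R -> R) theta0
    (phat : nat -> T -> 'cV[R]_M) (thetahat : nat -> T -> 'cV[R]_M0) :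
  (0 < M)%N -> \rank (row_mx (const_mx 1 : 'cV[R]_M) W) = M0.+1 -> admissible phi ->
  (forall N w, (0 < N)%N -> \sum_i phat N w i 0 = 1) ->
  (forall N w, (0 < N)%N ->
      (exists th : 'cV[R]_M0, forall th',
         (dphi phi (phat N w) (ploglin W th)
          <= dphi phi (phat N w) (ploglin W th'))%E) ->
      forall th',
        (dphi phi (phat N w) (ploglin W (thetahat N w))
         <= dphi phi (phat N w) (ploglin W th'))%E) ->
  forall K e : R, 0 < K -> 0 < e -> \forall N \near \oo, forall w,
    `|Num.sqrt N%:R *: (phat N w - ploglin W theta0)| <= K ->
    `|Num.sqrt N%:R *: (phat N w - ploglin W (thetahat N w)) -
      residual_mx W theta0 *m (Num.sqrt N%:R *: (phat N w - ploglin W theta0))| < e.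
Proof.
move=> M_gt0 W1 phia sp hmin K e K0 e0.
have e2 : 0 < e / (2 * K) by rewrite divr_gt0// mulr_gt0.
have [r r0 H] := residual_expansion M_gt0 W1 phia theta0 e2.
near=> N => w.
have N0 : (0 < N)%N by near: N; exact: nbhs_infty_gt.
have sN : 0 < Num.sqrt N%:R :> R by rewrite sqrtr_gt0 ltr0n.
have sK : K / r < Num.sqrt N%:R.
  have Kr : 0 <= K / r by rewrite divr_ge0// ltW.
  rewrite -(ger0_norm Kr) -sqrtr_sqr ltr_sqrt ?ltr0n//.
  by near: N; exact: nbhs_infty_gtr.
rewrite normrZ (gtr0_norm sN) => VK.
have pr : `|phat N w - ploglin W theta0| < r.
  rewrite -(ltr_pM2l sN); apply: le_lt_trans VK _.
  by rewrite -ltr_pdivrMr.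
have [p_gt0 [th thmin] close] := H _ (sp N w N0) pr.
have dE th' := dphi_phi_div W phi M_gt0 th' p_gt0.
have {}hmin th' : phi_div W phi (phat N w) (thetahat N w) <= phi_div W phi (phat N w) th'.
  rewrite -lee_fin -!dE; apply: hmin => //.
  by exists th => th''; rewrite !dE lee_fin.
rewrite -scalemxAr -scalerBr normrZ (gtr0_norm sN).
apply: (@le_lt_trans _ _ (e / (2 * K) * K)).
  apply: (@le_trans _ _ (e / (2 * K) * (Num.sqrt N%:R * `|phat N w - ploglin W theta0|))).
    by rewrite mulrCA ler_pM2l//; exact: close.
  by rewrite ler_pM2l.
rewrite invfM mulrA divfK ?gt_eqF// ltr_pdivrMr// ltr_pMr// ltr1n.
Unshelve. all: by end_near. Qed.

End estimator_limit.

Theorem theorem5 (R : realType) (d : measure_display) (T : measurableType d)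
  (P : probability T R)
  (M M0 : nat) (W : 'M[R]_(M, M0))
  (G : nat) (n : 'I_G -> nat) (Ng : nat -> 'I_G -> nat) (Nstar : 'I_G -> R)
  (rho2 : R) (theta0 : 'cV[R]_M0)
  (Y : nat -> forall g : 'I_G, nat -> T -> 'cV[R]_M)
  (phi : R -> R) (thetahat : nat -> T -> 'cV[R]_M0) :
  (* dimensions and design matrix *)
  (3 <= M)%N -> (1 <= M0)%N -> (M0 < M.-1)%N ->
  \rank W = M0 ->
  \rank (row_mx (const_mx 1 : 'cV[R]_M) W) = M0.+1 ->
  (* cluster sizes *)
  (forall g, 2 <= n g)%N -> injective n ->
  (forall N, (\sum_(g < G) Ng N g)%N = N) ->
  (forall g, 0 < Nstar g <= 1) ->
  (forall g, ((Ng N g)%:R / N%:R : R) @[N --> \oo] --> Nstar g) ->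
  0 <= rho2 ->
  (* the cluster frequency vectors at stage N *)
  (forall N g l, (l < Ng N g)%N -> rvec (Y N g l)) ->
  (forall N g l w i, (l < Ng N g)%N -> exists k : nat, Y N g l w i 0 = k%:R) ->
  (forall N g l w, (l < Ng N g)%N -> \sum_(i < M) Y N g l w i 0 = (n g)%:R) ->
  (forall N, mutually_independent P
     (fun gl : {g : 'I_G & 'I_(Ng N g)} => Y N (projT1 gl) (projT2 gl))) ->
  (forall N g l l', (l < Ng N g)%N -> (l' < Ng N g)%N ->
     same_law P (Y N g l) (Y N g l')) ->
  (forall N g l i, (l < Ng N g)%N ->
     (\int[P]_w (Y N g l w i 0)%:E
       = ((n g)%:R * ploglin W theta0 i 0)%:E)%E) ->
  (forall N g l i j, (l < Ng N g)%N ->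
     (\int[P]_w ((Y N g l w i 0 - (n g)%:R * ploglin W theta0 i 0)
                 * (Y N g l w j 0 - (n g)%:R * ploglin W theta0 j 0))%:E
       = ((1 + ((n g)%:R - 1) * rho2) * (n g)%:R
           * Sigmap (ploglin W theta0) i j)%:E)%E) ->
  (* the minimum phi-divergence estimator *)
  admissible phi ->
  (forall N, rvec (thetahat N)) ->
  (let phat N w : 'cV[R]_M :=
     (\sum_(h < G) ((n h)%:R * (Ng N h)%:R))^-1 *:
       \sum_(g < G) \sum_(l < Ng N g) Y N g l w in
   (forall N w, (0 < N)%N ->
      (exists th : 'cV[R]_M0, forall th',
         (dphi phi (phat N w) (ploglin W th)
          <= dphi phi (phat N w) (ploglin W th'))%E) ->
      forall th',
        (dphi phi (phat N w) (ploglin W (thetahat N w))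
         <= dphi phi (phat N w) (ploglin W th'))%E) ->
   (* conclusion *)
   let nbar := \sum_(g < G) Nstar g * (n g)%:R in
   let wstar g := Nstar g * (n g)%:R / nbar in
   let nstar := \sum_(g < G) wstar g * (n g)%:R in
   let Sig := Sigmap (ploglin W theta0) in
   let V := ((1 + rho2 * (nstar - 1)) / nbar) *:
     (Sig - Sig *m W *m invmx (W^T *m Sig *m W) *m W^T *m Sig) in
   forall (d' : measure_display) (T' : measurableType d')
     (Q : probability T' R) (Z : T' -> 'cV[R]_M),
     gaussian0 Q Z V ->
     conv_in_law P Q
       (fun N w => Num.sqrt (N%:R) *: (phat N w - ploglin W (thetahat N w)))
       Z).
Proof.
move=> M3 M01 M0M rkW W1 n2 n_inj sumNg Ns01 cvgNg rho0 mY Ynat Ysum Yind Ysame Ymean Ycov phia mth.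
move=> ph hmin nbar wstar nstar Sig V d' T' Q Z [mZ gZ].
have M_gt0 : (0 < M)%N by exact: leq_trans M3.
have n_gt0 g : (0 < n g)%N by exact: leq_trans (n2 g).
have Ns0 g : 0 < Nstar g by case/andP: (Ns01 g).
have mph N : rvec (ph N) := rvec_phat n mY N.
have cf := cvg_charfun M_gt0 n_gt0 sumNg Ns0 cvgNg mY Ynat Ysum Yind Ymean Ycov.
(* The residual matrix is moved from the scaled error onto [t], so [cvg_charfun] is used at the
   transposed image of [t]; [residual_covariance] matches the resulting variance with [V]. *)
have covE t : dot t (V *m t) = (1 + rho2 * (nstar - 1)) / nbar *
    dot ((residual_mx W theta0)^T *m t) (Sig *m ((residual_mx W theta0)^T *m t)).
  rewrite /V -(residual_covariance M_gt0 W1 theta0) -scalemxAl {1}/dot -scalemxAr mxE.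
  congr (_ * _); rewrite -[RHS]dot_mulmx /dot -/Sig.
  by rewrite !mulmxA.
have gcos t : \int[Q]_w cos (dot t (Z w)) = expR (- dot t (V *m t) / 2).
  have [h _] := gZ t; rewrite /Rintegral /dot h /=.
  by rewrite mulmxA.
have gsin t : \int[Q]_w sin (dot t (Z w)) = 0.
  by have [_ h] := gZ t; rewrite /Rintegral /dot h.
apply: (@slutsky_linear _ _ _ P _ _ Q _ (residual_mx W theta0) _
  (scaled_error W n Ng theta0 Y)) => //.
- move=> N i.
  have -> : (fun w => (Num.sqrt N%:R *: (ph N w - ploglin W (thetahat N w))) i 0) =
      (fun w => Num.sqrt N%:R * (ph N w i 0 - ploglin W (thetahat N w) i 0)).
    by apply/funext => w; rewrite mxE entryB.
  apply: measurable_funM => //; apply: measurable_funB; first exact: mph.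
  (* Coordinates of [p(theta)] are continuous in [theta] and bounded by 1. *)
  apply: (@measurable_continuous_rvec _ _ _ _ (thetahat N) (fun th => ploglin W th i 0) 1) => //.
    by move=> th; exact: ploglin_coord_continuous.
  by move=> th; exact: ploglin_le1.
- exact: rvec_scaled_error.
- exact: (tight_scaled_error M_gt0 n_gt0 sumNg mY Ynat Ysum Yind Ymean).
- move=> t; rewrite gcos covE; under eq_fun do under eq_Rintegral do rewrite dot_mulmx.
  exact: (cf _).1.
- move=> t; rewrite gsin; under eq_fun do under eq_Rintegral do rewrite dot_mulmx.
  exact: (cf _).2.
- have sph N w : (0 < N)%N -> \sum_i ph N w i 0 = 1.
    by move=> N0; exact: (sum_phat n_gt0 sumNg Ysum).
  exact: (@residual_close _ T M M0 W phi theta0 ph thetahat M_gt0 W1 phia sph hmin).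
Qed.
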